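(* Let $n\geq 3$ be an odd integer. Then $\nu(G(n,2))\geq n-1$, where $\nu$ denotes the Yang index and $G(n,2)$ carries the involution $T$ reversing the orientation of each $2$-plane.
   Context: All homology is with $\mathbb{Z}_2$ coefficients. Grassmannian. $St(n,k)=\{(v_1,\ldots,v_k) : v_i\in\mathbb{R}^n,\ v_i\cdot v_j=\delta_{i,j}\}$, and $G(n,k)=St(n,k)/SO(k)$ (right action) is the Grassmannian of oriented $k$-planes through the origin in $\mathbb{R}^n$, with the free involution $T$ reversing the orientation of each $k$-plane. Yang index. A $T$-space is a pair $(X,T)$ with $X$ a compact Hausdorff space and $T$ a fixed-point free involution of $X$. It is simplicial if $X$ is a finite simplicial complex whose simplices are permuted by $T$. For simplicial $(X,T)$, an $m$-chain $c$ is $T$-invariant if $T(c)=c$, equivalently $c=d+T(d)$ for some $m$-chain $d$. Let $C_m(X,T)$ be the group of $T$-invariant $m$-chains; $\partial$ restricts to these, and $H_m(X,T)=Z_m(X,T)/B_m(X,T)$, where $Z_m(X,T)$ is the kernel of $\partial_m$ on $C_m(X,T)$ and $B_m(X,T)$ is the image of $C_{m+1}(X,T)$ under $\partial_{m+1}$. For $c=d+T(d)\in Z_0(X,T)$, the index $\nu(c)\in\mathbb{Z}_2$ is the parity of the number of vertices in $d$; for $c=d+T(d)\in Z_m(X,T)$ with $m\ge 1$, $\nu(c)=\nu(\partial d)$, inductively. This is independent of choices and gives a homomorphism $\nu:H_m(X,T)\to\mathbb{Z}_2$. For an arbitrary $T$-space, $H_m(X,T)$ and $\nu$ are defined in the Čech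 manner, i.e. as the inverse limit over the nerves of finite $T$-invariant open covers all of whose members $U$ satisfy $U\cap T(U)=\emptyset$ ($H_m(X,T)$ is isomorphic to the $m$-th Čech homology group of $X/T$). The Yang index $\nu(X,T)$ is the largest integer $m$ such that $\nu(H_m(X,T))\neq\{0\}$. The involution is suppressed in the notation for $G(n,k)$. *)

(* Defs.v *)
From HB Require Import structures.
From mathcomp Require Import all_boot all_order all_algebra finmap.
From mathcomp Require Import mathcomp_extra boolp classical_sets functions reals.
From mathcomp Require Import topology normedtype.

Set Implicit Arguments.
Unset Strict Implicit.
Unset Printing Implicit Defensive.

Import Order.TTheory GRing.Theory Num.Theory numFieldNormedType.Exports.

Local Open Scope quotient_scope.
Local Open Scope ring_scope.

(* Mod 2 chains on a vertex set V are all functions from finite vertex sets to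
   'F_2; membership in a complex and dimension are imposed by [chains]. *)
Notation chain V := {ffun {set V} -> 'F_2}.

(* The boundary of a 0-chain is 0: the empty face is left out. *)
Definition boundary (V : finType) (c : chain V) : chain V :=
  [ffun s : {set V} =>
    \sum_(u : {set V} | [&& s != finset.set0, s \subset u & #|u| == #|s|.+1]) c u].

(* Chain map of a vertex map: a simplex on which f is not injective goes to 0. *)
Definition pushforward (V W : finType) (f : V -> W) (c : chain V) : chain W :=
  [ffun s : {set W} =>
    \sum_(u : {set V} | (f @: u == s) && (#|u| == #|s|)) c u].

Section SimplicialNu.
Variables (V : finType) (K : {set {set V}}) (t : V -> V).

Definition chains (m : nat) : {set chain V} :=
  [set c : chain V | [forall s, (c s != 0) ==> (s \in K) && (#|s| == m.+1)]].

Definition inv_chains (m : nat) : {set chain V} :=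
  [set c in chains m | pushforward t c == c].

Definition inv_cycles (m : nat) : {set chain V} :=
  [set c in inv_chains m | boundary c == 0].

Definition inv_boundaries (m : nat) : {set chain V} :=
  [set boundary c | c in inv_chains m.+1].

Definition homology_class (m : nat) (z : chain V) : {set chain V} :=
  [set z + b | b in inv_boundaries m].

Definition inv_homology (m : nat) : {set {set chain V}} :=
  [set homology_class m z | z in inv_cycles m].

(* Some d with c = d + T(d); the index does not depend on which one. *)
Definition half (m : nat) (c : chain V) : chain V :=
  odflt 0 [pick d in chains m | c == d + pushforward t d].

Fixpoint nu (m : nat) (c : chain V) : 'F_2 :=
  match m with
  | 0%N => \sum_(s : {set V}) half m c s
  | m'.+1 => nu m' (boundary (half m c))
  end.

(* The value on a representative; the index is constant on homology classes. *)
Definition class_nu (m : nat) (h : {set chain V}) : 'F_2 :=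
  nu m (odflt 0 [pick z in h]).

End SimplicialNu.

Record tspace := TSpace {
  tspace_carrier :> topologicalType;
  tinv : tspace_carrier -> tspace_carrier;
  tspace_compact : compact [set: tspace_carrier]%classic;
  tspace_hausdorff : hausdorff_space tspace_carrier;
  tinv_continuous : continuous tinv;
  tinvK : involutive tinv;
  tinv_free : forall x, tinv x <> x }.

Arguments tinv {_} _.

Record tcover (X : tspace) := TCover {
  members :> {fset (set X)};
  tcover_open : forall U, U \in members -> open U;
  tcover_cover : forall x : X, exists2 U, U \in members & U x;
  tcover_inv : forall U, U \in members -> (tinv @` U)%classic \in members;
  tcover_disj : forall U, U \in members -> (U `&` tinv @` U = set0)%classic }.

Definition tact (X : tspace) (A : tcover X) (U : A) : A :=
  FSetSub (tcover_inv (valP U)).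

(* The empty set is allowed as a member of a cover, but it is not a vertex of
   the nerve. *)
Definition nerve (X : tspace) (A : tcover X) : {set {set A}} :=
  [set s : {set A} | (s != finset.set0) &&
     `[< exists x : X, forall U : A, U \in s -> fsval U x >] ].

(* B refines A through p, which is an equivariant map on vertices of nerves. *)
Definition is_projection (X : tspace) (A B : tcover X) (p : B -> A) : Prop :=
  forall U : B, (fsval U !=set0)%classic ->
    (fsval U `<=` fsval (p U))%classic /\ p (tact U) = tact (p U).

Definition nerve_homology (X : tspace) (A : tcover X) (m : nat) :
    {set {set chain A}} :=
  inv_homology (nerve A) (@tact X A) m.

Definition nerve_map (X : tspace) (A B : tcover X) (p : B -> A) (m : nat)
    (h : {set chain B}) : {set chain A} :=
  [set pushforward p z + b
     | z in h, b in inv_boundaries (nerve A) (@tact X A) m].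

(* The inverse limit of the groups H_m(nerve). Projections B -> A between the
   same covers induce the same map on H_m, so compatibility is required for all
   of them. *)
Record cech_homology (X : tspace) (m : nat) := CechClass {
  cech_at :> forall A : tcover X, {set chain A};
  cech_atP : forall A, cech_at A \in nerve_homology A m;
  cech_compat : forall (A B : tcover X) (p : B -> A), is_projection p ->
    nerve_map p m (cech_at B) = cech_at A }.

(* The common value of nu on the components of h: equivariant simplicial maps
   preserve nu. *)
Definition cech_nu (X : tspace) (m : nat) (h : cech_homology X m) : 'F_2 :=
  xget 0 [set e | forall A : tcover X,
                    class_nu (nerve A) (@tact X A) m (h A) = e]%classic.

Definition nu_nontrivial (X : tspace) (m : nat) : Prop :=
  exists h : cech_homology X m, cech_nu h <> 0.

(* N is the largest integer m with nu(H_m(X, T)) <> 0; H_m vanishes for m < 0,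
   so m ranges over nat. *)
Definition is_yang_index (X : tspace) (N : nat) : Prop :=
  nu_nontrivial X N /\ forall m, nu_nontrivial X m -> (m <= N)%N.

(* The columns of A are the vectors v_1, ..., v_k. *)
Definition stiefel (R : realType) (n k : nat) : set 'M[R]_(n, k) :=
  [set A | A^T *m A = 1%:M]%classic.
Arguments stiefel : clear implicits.

Definition SO (R : realType) (k : nat) : set 'M[R]_k :=
  [set q | q^T *m q = 1%:M /\ \det q = 1]%classic.
Arguments SO : clear implicits.

Section Grassmannian.
Variables (R : realType) (n k : nat).

Definition gr_rel (A B : stiefel R n k) : bool :=
  `[< exists2 q, SO R k q & set_val B = set_val A *m q >].

Lemma SO1 : SO R k 1%:M.
Proof. by split; rewrite ?det1// trmx1 mulmx1. Qed.

Lemma SO_tr q : SO R k q -> SO R k q^T.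
Proof.
move=> [qq dq]; split; last by rewrite det_tr.
by rewrite trmxK; exact: mulmx1C.
Qed.

Lemma SO_mul q r : SO R k q -> SO R k r -> SO R k (q *m r).
Proof.
move=> [qq dq] [rr dr]; split; last by rewrite det_mulmx dq dr mulr1.
by rewrite trmx_mul mulmxA -(mulmxA _ q^T) qq mulmx1.
Qed.

Lemma gr_rel_equiv : equiv_class_of gr_rel.
Proof.
have sym : forall A B : stiefel R n k, gr_rel A B -> gr_rel B A.
  move=> A B /asboolP[q qSO AB]; apply/asboolP; exists q^T; first exact: SO_tr.
  by rewrite AB -mulmxA (mulmx1C qSO.1) mulmx1.
split=> [A|A B|B A C].
- by apply/asboolP; exists 1%:M; [exact: SO1|rewrite mulmx1].
- by apply/idP/idP; exact: sym.
- move=> /asboolP[q qSO qE] /asboolP[r rSO rE]; apply/asboolP.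
  by exists (q *m r); [exact: SO_mul|rewrite rE qE mulmxA].
Qed.

Canonical gr_equiv := EquivRelPack gr_rel_equiv.

Definition grassmannian : topologicalType :=
  quotient_topology {eq_quot gr_equiv}.

Definition gr_pi (A : stiefel R n k) : grassmannian := \pi_{eq_quot gr_equiv} A.

(* v_1, v_2, ..., v_k |-> - v_1, v_2, ..., v_k *)
Definition flip : 'M[R]_k := diag_mx (\row_(i < k) (-1) ^+ (i == 0 :> nat)).

Lemma flip_orth : flip^T *m flip = 1%:M.
Proof.
rewrite /flip tr_diag_mx mulmx_diag -diag_const_mx; congr diag_mx.
by apply/rowP => i; rewrite !mxE -expr2 sqrr_sign.
Qed.

Lemma stiefel_flipP (A : stiefel R n k) :
  set_val A *m flip \in stiefel R n k.
Proof.
apply/mem_set; rewrite /stiefel /= trmx_mul mulmxA -(mulmxA _ _^T).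
by rewrite (set_valP A) mulmx1 flip_orth.
Qed.

Definition stiefel_flip (A : stiefel R n k) : stiefel R n k :=
  SigSub (stiefel_flipP A).

Lemma stiefel_flipE A : set_val (stiefel_flip A) = set_val A *m flip.
Proof. by []. Qed.

(* Does not depend on the representative: see gr_flip_pi. *)
Definition gr_flip (x : grassmannian) : grassmannian :=
  gr_pi (stiefel_flip (repr x)).

Lemma gr_pi_eqP (A B : stiefel R n k) :
  gr_pi A = gr_pi B <-> exists2 q, SO R k q & set_val B = set_val A *m q.
Proof.
split=> [/eqmodP /asboolP //|]; move=> AB; apply/eqmodP; exact/asboolP.
Qed.

Lemma gr_piK (x : grassmannian) : gr_pi (repr x) = x.
Proof. exact: reprK. Qed.

Lemma flipK : flip *m flip = 1%:M.
Proof. by have := flip_orth; rewrite /flip tr_diag_mx. Qed.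

Lemma gr_flip_pi (A : stiefel R n k) : gr_flip (gr_pi A) = gr_pi (stiefel_flip A).
Proof.
have /gr_pi_eqP[q [qq dq] qE] := gr_piK (gr_pi A).
apply/gr_pi_eqP; exists (flip *m q *m flip).
  split; last by rewrite !det_mulmx dq mulr1 -det_mulmx flipK det1.
  rewrite !trmx_mul !mulmxA -(mulmxA (flip^T *m q^T)) flip_orth mulmx1.
  by rewrite -(mulmxA flip^T) qq mulmx1 flip_orth.
by rewrite !stiefel_flipE qE !mulmxA -(mulmxA _ flip flip) flipK mulmx1.
Qed.

Lemma gr_flipK : involutive gr_flip.
Proof.
move=> x; rewrite -(gr_piK x) !gr_flip_pi; congr gr_pi.
apply: val_inj; change (set_val (stiefel_flip (stiefel_flip (repr x))) = set_val (repr x)).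
by rewrite !stiefel_flipE -mulmxA flipK mulmx1.
Qed.

Lemma det_flip : (0 < k)%N -> \det flip = -1.
Proof.
move=> k0; rewrite det_diag (bigD1 (Ordinal k0)) //= !mxE eqxx expr1.
rewrite big1 ?mulr1// => i i0; rewrite !mxE; case: eqP => // i0'.
by move: i0; rewrite -val_eqE /= i0'.
Qed.

Lemma gr_flip_free : (0 < k)%N -> forall x, gr_flip x <> x.
Proof.
move=> k0 x; rewrite -(gr_piK x) gr_flip_pi => /gr_pi_eqP[q [_ dq]].
rewrite stiefel_flipE.
move=> /(congr1 (mulmx (set_val (repr x))^T)).
rewrite !mulmxA (set_valP (repr x)) !mul1mx => /(congr1 determinant).
rewrite det1 det_mulmx dq mulr1 det_flip// => /eqP.
by rewrite -addr_eq0 -mulr2n pnatr_eq0.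
Qed.

Lemma mx_continuous (T : topologicalType) p q (f : T -> 'M[R]_(p, q)) :
  (forall i j, continuous (fun x => f x i j)) -> continuous f.
Proof.
move=> cf x U [P fxP PU]; rewrite nbhs_filterE.
have : \forall y \near x, forall i j, P i j (f y i j).
  by apply: filter_forall => i; apply: filter_forall => j; exact/cf/fxP.
by apply: filterS => y Py; exact: PU.
Qed.

Lemma mx_coord_continuous p q i j : continuous (fun M : 'M[R]_(p, q) => M i j).
Proof. exact: coord_continuous. Qed.

Lemma mx_entry_continuous (T : topologicalType) p q (f : T -> 'M[R]_(p, q)) i j :
  continuous f -> continuous (fun x => f x i j).
Proof.
move=> cf x.
apply: (@continuous_comp _ _ _ f (fun M : 'M[R]_(p, q) => M i j)); first exact: cf.
exact: mx_coord_continuous.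
Qed.

Lemma sum_continuous (T : topologicalType) I (r : seq I) (P : pred I)
    (f : I -> T -> R) :
  (forall i, continuous (f i)) -> continuous (fun x => \sum_(i <- r | P i) f i x).
Proof. by move=> cf; apply: continuous_big => //; exact: add_continuous. Qed.

Lemma prod_continuous (T : topologicalType) I (r : seq I) (P : pred I)
    (f : I -> T -> R) :
  (forall i, continuous (f i)) -> continuous (fun x => \prod_(i <- r | P i) f i x).
Proof. by move=> cf; apply: continuous_big => //; exact: mul_continuous. Qed.

Lemma mulmx_continuous (T : topologicalType) p q r (f : T -> 'M[R]_(p, q))
    (g : T -> 'M[R]_(q, r)) :
  continuous f -> continuous g -> continuous (fun x => f x *m g x).
Proof.
move=> cf cg; apply: mx_continuous => i j.
under eq_fun do rewrite mxE.
apply: sum_continuous => l x; apply: continuousM; exact: mx_entry_continuous.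
Qed.

Lemma det_continuous (T : topologicalType) p (f : T -> 'M[R]_p) :
  continuous f -> continuous (fun x => \det (f x)).
Proof.
move=> cf; apply: sum_continuous => s.
move=> x; rewrite /continuous_at; apply: cvgM; first exact: cst_continuous.
by move: x; apply: prod_continuous => i; exact: mx_entry_continuous.
Qed.

Lemma trmx_continuous p q : continuous (@trmx R p q).
Proof.
apply: mx_continuous => i j; under eq_fun do rewrite mxE.
exact: mx_coord_continuous.
Qed.

Lemma stiefel_val_continuous : continuous (set_val : stiefel R n k -> 'M[R]_(n, k)).
Proof. exact: initial_continuous. Qed.

Lemma gr_pi_continuous : continuous gr_pi.
Proof. exact: pi_continuous. Qed.

Lemma stiefel_flip_continuous : continuous stiefel_flip.
Proof.
apply: (@continuous_comp_initial (set_type (stiefel R n k)) _ _ set_val stiefel_flip).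
apply: mulmx_continuous; first exact: stiefel_val_continuous.
exact: cst_continuous.
Qed.

Lemma gr_continuous (Z : topologicalType) (f : grassmannian -> Z) :
  continuous (f \o gr_pi) -> continuous f.
Proof. by move=> cf; apply/quotient_continuous. Qed.

Lemma gr_flip_continuous : continuous gr_flip.
Proof.
apply: gr_continuous.
rewrite (_ : gr_flip \o gr_pi = gr_pi \o stiefel_flip); last first.
  by apply/funext => A /=; rewrite gr_flip_pi.
move=> A; apply: continuous_comp; first exact: stiefel_flip_continuous.
exact: gr_pi_continuous.
Qed.

Lemma stiefel_mx_compact : compact (stiefel R n k).
Proof.
pose B : set 'rV[R]_(n * k) :=
  [set v | forall i, `[-1, 1]%classic (v ord0 i)]%classic.
have cB : compact B by apply: (@rV_compact R _ (fun=> `[-1, 1]%classic)) => _; exact: segment_compact.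
have cvec : continuous (vec_mx : 'rV[R]_(n * k) -> 'M[R]_(n, k)).
  apply: mx_continuous => i j; under eq_fun do rewrite mxE.
  exact: mx_coord_continuous.
have cvB : compact (vec_mx @` B)%classic.
  by apply: continuous_compact => //; exact: continuous_subspaceT.
apply: (subclosed_compact _ cvB) => [|A AA].
  rewrite (_ : stiefel R n k = \bigcap_(ij in [set: 'I_k * 'I_k])
     ((fun A : 'M[R]_(n, k) => (A^T *m A) ij.1 ij.2) @^-1`
       [set x | x = (1%:M : 'M[R]_k) ij.1 ij.2]))%classic; last first.
    apply/seteqP; split => [A /= AA ij _ /=|A AA]; first by rewrite AA.
    by apply/matrixP => i j; exact: (AA (i, j)).
  apply: closed_bigI => -[i j] _ /=.
  apply: (continuous_closedP _).1; last exact: closed_eq.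
  apply: (@mx_entry_continuous _ _ _ (fun A : 'M[R]_(n, k) => A^T *m A)).
  by apply: mulmx_continuous; [exact: trmx_continuous|move=> ?; exact: cvg_id].
exists (mxvec A); last exact: mxvecK.
move=> ij /=; case/mxvec_indexP: ij => i j; rewrite mxvecE in_itv /= -ler_norml.
rewrite -(@expr_le1 _ 2)// real_normK ?num_real//.
have <- : \sum_l A l j ^+ 2 = 1.
  move/matrixP/(_ j j): AA; rewrite !mxE eqxx mulr1n => <-.
  by apply: eq_bigr => l _; rewrite mxE expr2.
by rewrite (bigD1 i) //= lerDl sumr_ge0 // => l _; exact: sqr_ge0.
Qed.

Lemma stiefel_compact : compact [set: stiefel R n k]%classic.
Proof.
move=> F FF _.
have GF : ProperFilter (fmap set_val F) by exact: fmap_proper_filter.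
have [|A [stA clA]] := @stiefel_mx_compact (fmap set_val F) GF.
  by apply: (@filterS _ F _ setT); [move=> x _; exact: set_valP|exact: filterT].
exists (SigSub (mem_set stA)); split => // C D FC; rewrite nbhsE => -[_ [[W oW <-] WA] WD].
have [||_ [[x Cx <-] Wx]] := clA (set_val @` C)%classic W.
- by apply: (@filterS _ F _ C) => // x Cx; exists x.
- by apply: open_nbhs_nbhs; split.
by exists x; split => //; exact: WD.
Qed.

Lemma gr_compact : compact [set: grassmannian]%classic.
Proof.
rewrite (_ : setT = gr_pi @` setT)%classic; last first.
  by apply/seteqP; split => // x _; exists (repr x) => //; exact: gr_piK.
apply: continuous_compact; last exact: stiefel_compact.
exact/continuous_subspaceT/gr_pi_continuous.
Qed.

Lemma separated_hausdorff (X : topologicalType) :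
  (forall x y : X, x <> y -> exists2 f : X -> R, continuous f & f x <> f y) ->
  hausdorff_space X.
Proof.
move=> sep x y clxy; apply: contrapT => /sep[f cf]; apply.
apply: (@Rhausdorff R) => U V Ufx Vfy.
by have [z [Uz Vz]] := clxy _ _ (cf x _ Ufx) (cf y _ Vfy); exists (f z).
Qed.

Lemma gr_invariant_continuous (f : 'M[R]_(n, k) -> R) :
  (forall A q, SO R k q -> f (A *m q) = f A) -> continuous f ->
  exists2 g : grassmannian -> R, continuous g &
    forall A, g (gr_pi A) = f (set_val A).
Proof.
move=> fSO cf; pose g (x : grassmannian) := f (set_val (repr x)).
have gE A : g (gr_pi A) = f (set_val A).
  have /gr_pi_eqP[q qSO ->] := gr_piK (gr_pi A).
  by rewrite fSO.
exists g => //; apply: gr_continuous.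
rewrite (_ : g \o gr_pi = f \o set_val); last exact/funext.
by move=> A; apply: continuous_comp; [exact: stiefel_val_continuous|exact: cf].
Qed.

Lemma gr_hausdorff : hausdorff_space grassmannian.
Proof.
apply: separated_hausdorff => x y; rewrite -(gr_piK x) -(gr_piK y).
move: (repr x) (repr y) => {x y} A B AB.
have stA := set_valP A; have stB := set_valP B.
have idc : continuous (fun M : 'M[R]_(n, k) => M) by move=> ?; exact: cvg_id.
have [PAB|/eqP] := eqVneq (set_val A *m (set_val A)^T) (set_val B *m (set_val B)^T).
  pose q := (set_val A)^T *m set_val B.
  have qB : set_val B = set_val A *m q by rewrite /q mulmxA PAB -mulmxA stB mulmx1.
  have qq : q^T *m q = 1%:M.
    by rewrite /q trmx_mul trmxK mulmxA -(mulmxA _ (set_val A)) PAB -!mulmxA stB !mulmx1 stB.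
  have rA : row_full (set_val A) by apply/row_fullP; exists (set_val A)^T.
  pose f := fun M : 'M[R]_(n, k) => \det (rowsub (fullrankfun rA) M).
  have fM M p : f (M *m p) = f M * \det p by rewrite /f -mul_rowsub_mx det_mulmx.
  have [| |g cg gE] := gr_invariant_continuous (f := f).
  - by move=> M p [_ dp]; rewrite fM dp mulr1.
  - apply: det_continuous; apply: mx_continuous => i j.
    by under eq_fun do rewrite mxE; exact: mx_coord_continuous.
  exists g => //; rewrite !gE qB fM => fAB; apply: AB.
  apply/gr_pi_eqP; exists q => //; split => //.
  have fA : f (set_val A) != 0.
    by have := fullrowsub_unit rA; rewrite unitmxE unitfE.
  by apply: (mulfI fA); rewrite -fAB mulr1.
move=> PAB.
have [i [j Pij]] : exists i j, (set_val A *m (set_val A)^T) i j <>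
    (set_val B *m (set_val B)^T) i j.
  apply: contrapT => /forallNP H; apply: PAB; apply/matrixP => i j.
  by move/forallNP: (H i) => /(_ j) /contrapT.
have [| |g cg gE] := gr_invariant_continuous (f := fun M => (M *m M^T) i j).
- move=> M p [pp _]; rewrite trmx_mul mulmxA -(mulmxA M) (mulmx1C pp).
  by rewrite mulmx1.
- apply: (@mx_entry_continuous _ _ _ (fun A : 'M[R]_(n, k) => A *m A^T)).
  by apply: mulmx_continuous => //; exact: trmx_continuous.
by exists g => //; rewrite !gE.
Qed.

Definition gr_tspace (k0 : (0 < k)%N) : tspace :=
  TSpace gr_compact gr_hausdorff gr_flip_continuous gr_flipK (gr_flip_free k0).

End Grassmannian.

Arguments gr_tspace : clear implicits.

(* Main.v *)
Require Import Defs.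
From HB Require Import structures.
From mathcomp Require Import all_boot all_order all_algebra finmap.
From mathcomp Require Import mathcomp_extra boolp classical_sets functions reals.
From mathcomp Require Import topology normedtype.
From mathcomp Require Import ssrAC ring sequences realfun.

(** Write [x] and [y] for the first Stiefel-Whitney classes of the two tautological
    lines over the manifold of pairs of orthogonal lines of R^n, the first one lying
    in a fixed 2-plane.  There [x^2 = 0] and [y^(n-1) = x y^(n-2)], so the class [x + y]
    of the 2-plane satisfies [(x + y)^(n-1) = n x y^(n-2)], which is nonzero for odd [n].

    In terms of chains: the double cover of this manifold is a prism over the sphere
    S^(n-2) whose ends are glued by a map [twist] that fixes one coordinate and negates
    the others.  Halving the prism over S^(n-2) along the fixed coordinate leaves the
    prism over S^(n-3), because the two copies of the hemisphere cancel; halving the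
    prism over S^k along a negated coordinate leaves the prism over S^(k-1) and the end
    S^k, whose index is 1.  Hence the index of the prism over S^(n-2) is the parity of
    [n - 2].

    Subdivided finely enough, this cycle can be pushed to the nerve of any invariant
    cover, and a limit along an ultrafilter of covers makes the images compatible.
    The index is bounded because a nerve has finite dimension. *)

Set Implicit Arguments.
Unset Strict Implicit.
Unset Printing Implicit Defensive.

Import Order.TTheory GRing.Theory Num.Theory numFieldNormedType.Exports.
Local Open Scope ring_scope.

(** * Faces of ordered simplices and simplicial chains *)

(** Chains are functions on the subsets of a finite type, while the simplices of the prism have
    their vertices among infinitely many points of a vector space. The prism and its subdivisions
    are therefore never chains themselves: they are functionals that sum a given value over ordered
    simplices, and only the resulting values, in the chain group of a nerve, are chains. Operators
    on functionals compose in reverse: [dl (sd G)] evaluates [G] on the subdivided boundary,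
    [sd (dl G)] on the boundary of the subdivision. The glued ends must agree, and the involution
    must exchange the two halves, exactly as chains of the nerve. Two choices ensure this.
    Barycentric subdivision commutes with linear maps, hence with both the antipode and the twist.
    And the member of the cover attached to a simplex depends only, and equivariantly, on the set of
    its image points in the Grassmannian, so simplices with the same image set give the same vertex
    of the nerve. *)

Lemma addF2 (x : 'F_2) : x + x = 0.
Proof. by case: x => [[|[|]]] //= i; apply/val_inj. Qed.

Lemma addcc (V : finType) (c : chain V) : c + c = 0.
Proof. by apply/ffunP => s; rewrite !ffunE addF2. Qed.

Lemma addcK (V : finType) (c d : chain V) : c + d + d = c.
Proof. by rewrite -addrA addcc addr0. Qed.

Lemma F2_neq0 (x : 'F_2) : x != 0 -> x = 1.
Proof. by case: x => [[|[|]]] //= i _; apply/val_inj. Qed.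

Section Faces.
Variables (P : Type) (M : zmodType).
Implicit Types (G : seq P -> M) (x : seq P).

(* A chain of ordered simplices is represented by the functional that it defines
   on functions of simplices: [dl G x] evaluates G on the boundary of x. *)
Fixpoint dl G x : M :=
  if x is v :: x' then G x' + dl (fun y => G (v :: y)) x' else 0.

Inductive face : seq P -> seq P -> Prop :=
| face_hd v x : face x (v :: x)
| face_tl v z x : face z x -> face (v :: z) (v :: x).

End Faces.

Lemma face_size P (z x : seq P) : face z x -> size x = (size z).+1.
Proof. by elim=> //= v {}z {}x _ ->. Qed.

Lemma face_sub (P : eqType) (z x : seq P) : face z x -> {subset z <= x}.
Proof.
elim=> [v y w wy|v {}z {}x _ IH w]; rewrite !inE ?wy ?orbT//.
by case/predU1P => [->|/IH ->]; rewrite ?eqxx ?orbT.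
Qed.

Lemma face_subseq (P : eqType) (z x : seq P) : face z x -> subseq z x.
Proof.
elim=> [v y|v {}z {}x _ IH]; first exact: subseq_cons.
by rewrite /= eqxx.
Qed.

(** [dl] only adds up values on faces, so a relation compatible with sums passes from the faces to
    the total. [sd_rel] and [iter_sd_rel] extend the principle to subdivisions, with [Rel] an
    equality, the graph of a chain map or membership in a chain group. *)
Lemma dl_rel (P P' : Type) (M M' : zmodType) (Rel : M -> M' -> Prop) (f : P -> P') :
  Rel 0 0 -> (forall a b a' b', Rel a b -> Rel a' b' -> Rel (a + a') (b + b')) ->
  forall x (G : seq P -> M) (G' : seq P' -> M'),
  (forall z, face z x -> Rel (G z) (G' (map f z))) -> Rel (dl G x) (dl G' (map f x)).
Proof.
move=> R0 RD; elim=> //= v x IH G G' GG'; apply: RD; first exact/GG'/face_hd.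
by apply: IH => z zx; exact/GG'/face_tl.
Qed.

Lemma eq_dl P (M : zmodType) (G G' : seq P -> M) x :
  (forall z, face z x -> G z = G' z) -> dl G x = dl G' x.
Proof.
move=> GG'; have := @dl_rel P P M M eq id erefl _ x G G'.
rewrite map_id; apply=> [_ _ a b -> ->//|z]; rewrite map_id; exact: GG'.
Qed.

Lemma dlD P (M : zmodType) (G G' : seq P -> M) x :
  dl (fun z => G z + G' z) x = dl G x + dl G' x.
Proof.
by elim: x G G' => [|v x IH] G G' /=; rewrite ?addr0// IH addrACA.
Qed.

Lemma dl0 P (M : zmodType) x : dl (fun _ : seq P => 0 : M) x = 0.
Proof. by elim: x => //= v x ->; rewrite addr0. Qed.

Lemma dl_map P Q (M : zmodType) (f : P -> Q) (G : seq Q -> M) x :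
  dl G (map f x) = dl (fun z => G (map f z)) x.
Proof. by elim: x G => //= v x IH G; rewrite IH. Qed.

Lemma dl_add P (M M' : zmodType) (h : {additive M -> M'}) (G : seq P -> M) x :
  h (dl G x) = dl (fun z => h (G z)) x.
Proof. by elim: x G => [|v x IH] G /=; rewrite ?raddf0// raddfD IH. Qed.

Lemma dl_dl P (M : zmodType) (G : seq P -> M) x :
  (forall a : M, a + a = 0) -> dl (dl G) x = 0.
Proof.
move=> M2; elim: x G => //= v x IH G; rewrite dlD IH addr0; exact: M2.
Qed.

Section Linear.
Variables (V W : finType).

Lemma boundary_is_zmod_morphism : zmod_morphism (@boundary V).
Proof.
move=> c d; apply/ffunP => s; rewrite !ffunE -sumrB.
by apply: eq_bigr => u _; rewrite !ffunE.
Qed.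
HB.instance Definition _ := GRing.isZmodMorphism.Build (chain V) (chain V)
  (@boundary V) boundary_is_zmod_morphism.

Lemma pushforward_is_zmod_morphism (f : V -> W) : zmod_morphism (pushforward f).
Proof.
move=> c d; apply/ffunP => s; rewrite !ffunE -sumrB.
by apply: eq_bigr => u _; rewrite !ffunE.
Qed.
HB.instance Definition _ (f : V -> W) := GRing.isZmodMorphism.Build (chain V) (chain W)
  (pushforward f) (pushforward_is_zmod_morphism f).

End Linear.

(** * From ordered simplices to chains on vertex sets *)

Section Sym.
Variable V : finType.
Implicit Types (x : seq V) (s u : {set V}) (c : chain V).

(** A repeated vertex gives 0, the convention of [pushforward] for collapsed simplices. The empty
    list gives 0 because [boundary] leaves out the empty face; otherwise [boundary_sym] would fail
    on a single vertex. *)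
Definition sym x : chain V :=
  if uniq x && (x != [::]) then [ffun s => (s == [set y in x])%:R] else 0.

Lemma sym_nil : sym [::] = 0. Proof. by []. Qed.

Lemma sym_nuniq x : ~~ uniq x -> sym x = 0.
Proof. by rewrite /sym => /negbTE ->. Qed.

Lemma symE x s : x != [::] -> uniq x -> sym x s = (s == [set y in x])%:R.
Proof. by rewrite /sym => -> ->; rewrite ffunE. Qed.

Lemma sym_perm x y : perm_eq x y -> sym x = sym y.
Proof.
move=> xy; rewrite /sym (perm_uniq xy) -!size_eq0 (perm_size xy).
case: ifP => // _; apply/ffunP => s; rewrite !ffunE; congr (_ == _)%:R.
by apply/setP => z; rewrite !inE (perm_mem xy).
Qed.

(** If a single pair of entries coincides, the faces that drop one or the other of them are
    permutations of each other and cancel, and all other faces keep the repetition. Otherwise every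
    face has a repetition. *)
Lemma dl_nuniq (M : zmodType) (G : seq V -> M) x :
  (forall a : M, a + a = 0) ->
  (forall y, ~~ uniq y -> G y = 0) -> (forall y z, perm_eq y z -> G y = G z) ->
  ~~ uniq x -> dl G x = 0.
Proof.
move=> M2; elim: x G => //= v x IH G G0 Gp.
rewrite negb_and negbK; have [ux /=|nux _] := boolP (uniq x); last first.
  rewrite G0// add0r; apply: IH => // y; last by move=> z yz; apply/Gp; rewrite perm_cons.
  by move=> uy; apply: G0; rewrite /= negb_and uy orbT.
rewrite orbF => vx.
suff -> : dl (fun y => G (v :: y)) x = G x by exact: M2.
(* [w] collects the entries of [x] already passed, over which [v] is moved by permutation. *)
clear IH; have : forall w, dl (fun y => G (w ++ v :: y)) x = G (w ++ x).
  elim: x ux vx => //= b x IHx /andP[bx ux]; rewrite inE => /predU1P[->|vx] w.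
    rewrite [dl _ _](_ : _ = 0) ?addr0//.
    rewrite -[RHS](dl0 _ x); apply: eq_dl => z _; apply: G0.
    by rewrite cat_uniq /= inE eqxx !andbF.
  rewrite G0 ?add0r; last by rewrite cat_uniq /= vx !andbF.
  rewrite -cat_rcons -(IHx ux vx); apply: eq_dl => z _; apply: Gp.
  by rewrite -cats1 -catA perm_cat2l /= -(cat1s v) -(cat1s b) perm_catCA.
by move=> /(_ [::]).
Qed.

Lemma dl_uniq (M : zmodType) (G : seq V -> M) x : uniq x ->
  dl G x = \sum_(v <- x) G [seq y <- x | y != v].
Proof.
elim: x G => [|v x IH] G /=; first by rewrite big_nil.
case/andP=> vx ux; rewrite big_cons eqxx /= IH// (_ : [seq y <- x | y != v] = x).
  congr (_ + _); apply: eq_big_seq => w wx /=.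
  by case: eqP => // vw; rewrite vw wx in vx.
by apply/all_filterP/allP => w wx; apply: contraNneq vx => <-.
Qed.

(** Links the set-based boundary with the one on lists, so that simplicial identities can be proved
    by induction on lists. *)
Lemma boundary_sym x : boundary (sym x) = dl sym x.
Proof.
have [ux|nux] := boolP (uniq x); last first.
  rewrite sym_nuniq// raddf0 dl_nuniq//; first exact: addcc.
    exact: sym_nuniq.
  exact: sym_perm.
rewrite dl_uniq//; have [->|xn0] := eqVneq x [::]; first by rewrite sym_nil raddf0 big_nil.
apply/ffunP => s; rewrite sum_ffunE ffunE.
set X := [set y in x].
have cX : #|X| = size x by rewrite /X cardsE; exact/card_uniqP.
rewrite (eq_bigr (fun u => (u == X)%:R)); last by move=> u _; rewrite symE.
have sE v : v \in x -> sym [seq y <- x | y != v] s =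
    ((s != finset.set0) && (s == X :\ v))%:R.
  move=> vx; rewrite /sym filter_uniq//=.
  have XvE : [set y in [seq y <- x | y != v]] = X :\ v.
    by apply/setP => y; rewrite !inE mem_filter.
  have [f0|fn0] /= := eqVneq; last first.
    rewrite ffunE XvE; have [->|] := eqVneq s; rewrite ?andbF// andbT.
    rewrite -XvE; case: {XvE}[seq y <- x | y != v] fn0 => // w r _.
    by rewrite (_ : _ != _)//; apply/set0Pn; exists w; rewrite !inE eqxx.
  suff -> : X :\ v = finset.set0 by rewrite ffunE andNb.
  by rewrite -XvE f0; apply/setP => y; rewrite !inE.
rewrite (eq_big_seq _ sE) big_mkcond (bigD1 X)//= eqxx.
rewrite big1 ?addr0; last by move=> u /negbTE ->; case: ifP.
have memX y : (y \in X) = (y \in x) by rewrite inE.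
case: ifPn => [/and3P[s0 sX /eqP cs]|ns]; last first.
  rewrite big_seq big1// => v vx; case: (boolP (_ && _)) => // /andP[s0 /eqP sXv].
  case/negP: ns; rewrite s0 sXv subD1set/=.
  by rewrite (cardsD1 v X) memX vx.
(* [s] is a facet of [X]: a single vertex [v] is missing, and only the face that drops [v]
   contributes. *)
have /cards1P[v Xsv] : #|X :\: s| == 1%N.
  by rewrite cardsD (finset.setIidPr sX) cs subSnn.
have [vX vs] : v \in X /\ v \notin s.
  by have := set11 v; rewrite -Xsv !inE => /andP[].
have XvE w : (s == X :\ w) = (w == v).
  apply/eqP/eqP => [sw|->]; last by rewrite -Xsv finset.setDDr finset.setDv finset.set0U (finset.setIidPr sX).
  by have := vs; rewrite sw !inE negb_and negbK -memX vX orbF => /eqP.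
rewrite (bigD1_seq v) -?memX//= s0 XvE eqxx big1 ?addr0// => w /negbTE wv.
by rewrite XvE wv.
Qed.

End Sym.

Lemma pushforward_sym (V W : finType) (f : V -> W) (x : seq V) :
  pushforward f (sym x) = sym (map f x).
Proof.
have [ux|nux] := boolP (uniq x); last first.
  rewrite !sym_nuniq ?raddf0//; apply: contra nux; exact: map_uniq.
have [->|xn0] := eqVneq x [::]; first by rewrite sym_nil raddf0.
set X := [set y in x].
have cX : #|X| = size x by rewrite /X cardsE; exact/card_uniqP.
have fX : f @: X = [set y in map f x].
  apply/setP => w; rewrite inE; apply/imsetP/mapP => -[v vx ->]; exists v => //.
    by move: vx; rewrite inE.
  by rewrite inE.
apply/ffunP => s; rewrite ffunE.
rewrite big_mkcond (bigD1 X)//= symE// eqxx big1 ?addr0; last first.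
  by move=> u /negbTE uX; rewrite symE// uX; case: ifP.
have fx0 : map f x != [::] by case: (x) xn0.
have cf : (#|X| == #|f @: X|) = uniq (map f x).
  have -> : #|f @: X| = #|map f x| by rewrite fX cardsE.
  rewrite cX -(size_map f x) eq_sym.
  by apply/eqP/idP => [/card_uniqP|/card_uniqP].
rewrite /sym fx0 andbT -cf; have [<-|fXs] /= := eqVneq (f @: X) s.
  by case: ifP => _; rewrite ffunE // -fX eqxx.
by case: ifP => _; rewrite ffunE // -fX eq_sym (negbTE fXs).
Qed.

Lemma chainsP (V : finType) (K : {set {set V}}) m (c : chain V) :
  reflect (forall s, c s != 0 -> s \in K /\ #|s| = m.+1) (c \in chains K m).
Proof.
rewrite inE; apply: (iffP forallP) => cK s; last by apply/implyP => /cK[-> ->]/=.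
by move=> cs; have /implyP/(_ cs)/andP[-> /eqP] := cK s.
Qed.

Lemma chains0 (V : finType) (K : {set {set V}}) m : 0 \in chains K m.
Proof. by apply/chainsP => s; rewrite ffunE eqxx. Qed.

Lemma chainsD (V : finType) (K : {set {set V}}) m c d :
  c \in chains K m -> d \in chains K m -> c + d \in chains K m.
Proof.
move=> /chainsP cK /chainsP dK; apply/chainsP => s; rewrite ffunE.
by have [->|/cK//] := eqVneq (c s) 0; rewrite add0r; exact: dK.
Qed.

Lemma sym_chains (V : finType) (K : {set {set V}}) m (x : seq V) :
  size x = m.+1 -> [set y in x] \in K -> sym x \in chains K m.
Proof.
move=> sx xK; have [ux|/sym_nuniq->] := boolP (uniq x); last exact: chains0.
apply/chainsP => s; rewrite symE//; last by rewrite -size_eq0 sx.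
have [->|] := eqVneq s [set y in x]; last by rewrite eqxx.
by rewrite cardsE (card_uniqP ux).
Qed.

(** The listing [L] of the simplices is a parameter because the prism operator needs an order
    compatible with the involution, while [enum] suffices elsewhere. *)
Lemma chains_ind (V : finType) (K : {set {set V}}) m (L : {set V} -> seq V)
    (Q : chain V -> Prop) :
  (forall s, uniq (L s) /\ [set y in L s] = s) ->
  Q 0 -> (forall c d, Q c -> Q d -> Q (c + d)) ->
  (forall s, s \in K -> #|s| = m.+1 -> Q (sym (L s))) ->
  forall c, c \in chains K m -> Q c.
Proof.
move=> LE Q0 QD QL c /chainsP cK.
suff -> : c = \sum_(s | c s != 0) sym (L s).
  by apply: big_ind => // s /cK[]; exact: QL.
apply/ffunP => u; rewrite sum_ffunE.
have symL s : c s != 0 -> sym (L s) u = (u == s)%:R.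
  move=> /cK[_ cs]; have [uL LsE] := LE s; rewrite symE ?LsE//.
  apply: contra_eq_neq cs => L0; by rewrite -LsE L0 cardsE card0.
rewrite (eq_bigr _ symL); have [cu|cu] := eqVneq (c u) 0.
  rewrite big1 ?cu// => s; case: (eqVneq u s) => // <-; by rewrite cu.
by rewrite (bigD1 u)//= eqxx (F2_neq0 cu) big1 ?addr0// => s /andP[_]; rewrite eq_sym => /negbTE ->.
Qed.

Lemma boundaryD (V : finType) (c d : chain V) :
  boundary (c + d) = boundary c + boundary d.
Proof. exact: raddfD. Qed.

Lemma pushforwardD (V W : finType) (f : V -> W) (c d : chain V) :
  pushforward f (c + d) = pushforward f c + pushforward f d.
Proof. exact: raddfD. Qed.

Lemma enum_list (V : finType) (s : {set V}) : uniq (enum s) /\ [set y in enum s] = s.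
Proof. by split; [exact: enum_uniq|apply/setP => y; rewrite inE mem_enum]. Qed.

Section Maps.
Variables (V W : finType) (K : {set {set V}}) (f : V -> W).
Implicit Types (c : chain V) (m : nat).

Lemma boundary_boundary m c : c \in chains K m -> boundary (boundary c) = 0.
Proof.
move: c; apply: (chains_ind (@enum_list V)) => [|d e|s _ _]; rewrite ?raddf0 ?raddfD//=.
  by move=> -> ->; rewrite addr0.
rewrite boundary_sym dl_add -[RHS](dl_dl (@sym V) (enum s) (@addcc V)).
by apply: eq_dl => z _ /=; rewrite boundary_sym.
Qed.

Lemma boundary_pushforward m c : c \in chains K m ->
  boundary (pushforward f c) = pushforward f (boundary c).
Proof.
move: c; apply: (chains_ind (@enum_list V)) => [|d e|s _ _]; rewrite ?raddf0 ?raddfD//=.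
  by move=> -> ->.
rewrite pushforward_sym !boundary_sym dl_map dl_add.
by apply: eq_dl => z _ /=; rewrite pushforward_sym.
Qed.

Lemma eq_pushforward (g : V -> W) m c : c \in chains K m ->
  (forall s v, s \in K -> v \in s -> f v = g v) -> pushforward f c = pushforward g c.
Proof.
move=> cK fg; move: c cK.
apply: (chains_ind (@enum_list V)) => [|d e|s sK _]; rewrite ?raddf0 ?raddfD//=.
  by move=> -> ->.
rewrite !pushforward_sym; congr sym; apply/eq_in_map => v.
by rewrite mem_enum; exact: fg.
Qed.

Lemma pushforward_comp (X : finType) (g : W -> X) m c : c \in chains K m ->
  pushforward g (pushforward f c) = pushforward (g \o f) c.
Proof.
move: c; apply: (chains_ind (@enum_list V)) => [|d e|s _ _]; rewrite ?raddf0 ?raddfD//=.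
  by move=> -> ->.
by rewrite !pushforward_sym -map_comp.
Qed.

Lemma pushforward_chains (K' : {set {set W}}) m c : c \in chains K m ->
  (forall s, s \in K -> f @: s \in K') -> pushforward f c \in chains K' m.
Proof.
move=> cK fK; move: c cK.
apply: (chains_ind (@enum_list V)) => [|d e|s sK cs]; rewrite ?raddf0 ?chains0//=.
  by rewrite raddfD; exact: chainsD.
rewrite pushforward_sym; apply: sym_chains; first by rewrite size_map -cardE.
rewrite (_ : [set y in _] = f @: s); first exact: fK.
apply/setP => w; rewrite inE; apply/mapP/imsetP => -[v]; rewrite ?mem_enum => vs ->.
  by exists v.
by exists v; rewrite ?mem_enum.
Qed.

Lemma boundary_chains m c :
  (forall s u : {set V}, s \in K -> u \subset s -> u != finset.set0 -> u \in K) ->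
  c \in chains K m.+1 -> boundary c \in chains K m.
Proof.
move=> Kd /chainsP cK; apply/chainsP => s; rewrite ffunE => sn0.
have [u /andP[/and3P[s0 su /eqP cus] /cK[uK cu]]] :
    exists u : {set V}, [&& s != finset.set0, s \subset u & #|u| == #|s|.+1] && (c u != 0).
  apply/existsP; apply: contraNT sn0; rewrite negb_exists => /forallP nu.
  by rewrite big1// => u Cu; apply/eqP; have := nu u; rewrite Cu negbK.
by split; [exact: Kd su s0|apply: succn_inj; rewrite -cus].
Qed.

End Maps.

(** * The index on free complexes *)

(** The last condition is stronger than the absence of fixed vertices: no simplex meets its image.
    In a nerve it comes from the disjointness of a member and its image. *)
Definition free_complex (V : finType) (K : {set {set V}}) (t : V -> V) : Prop :=
  [/\ involutive t,
      forall s, s \in K -> s != finset.set0,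
      forall s u : {set V}, s \in K -> u \subset s -> u != finset.set0 -> u \in K,
      forall s, s \in K -> t @: s \in K &
      forall s v, s \in K -> v \in s -> t v \notin s].

Lemma sum_sym1 (V : finType) (a : V) : \sum_u sym [:: a] u = 1.
Proof.
rewrite (bigD1 [set a])//= big1 ?addr0 => [|u ua]; rewrite symE//.
  by rewrite (_ : _ == _)//; apply/eqP/setP => v; rewrite !inE.
rewrite (_ : [set _ in _] = [set a]) ?(negbTE ua)//.
by apply/setP => v; rewrite !inE.
Qed.

Section Involution.
Variables (V : finType) (K : {set {set V}}) (t : V -> V).
Hypothesis Kt : free_complex K t.
Implicit Types (c d : chain V) (m : nat).

Let tK : involutive t. Proof. by case: Kt. Qed.

Let Kdown (s u : {set V}) : s \in K -> u \subset s -> u != finset.set0 -> u \in K.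
Proof. by case: Kt => _ _ + _ _; exact. Qed.

Let Kinv s : s \in K -> t @: s \in K.
Proof. by case: Kt => _ _ _ + _; exact. Qed.

Lemma imset_invK (s : {set V}) : t @: (t @: s) = s.
Proof. by rewrite -imset_comp -[RHS]imset_id; apply: eq_imset => v /=; rewrite tK. Qed.

Lemma pushforward_invE c s : pushforward t c s = c (t @: s).
Proof.
rewrite ffunE (big_pred1 (t @: s)) // => u /=; apply/andP/eqP => [[/eqP <- _]|->].
  by rewrite imset_invK.
by rewrite imset_invK card_imset//; exact: inv_inj.
Qed.

Lemma pushforward_invK c : pushforward t (pushforward t c) = c.
Proof. by apply/ffunP => s; rewrite !pushforward_invE imset_invK. Qed.

Lemma inv_chains_half m c : c \in inv_chains K t m ->
  exists2 d, d \in chains K m & c = d + pushforward t d.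
Proof.
rewrite inE => /andP[/chainsP cK /eqP ct].
(* One simplex of each orbit is kept; a tie would mean [t @: s = s], which freeness excludes. *)
pose lt_orbit (s : {set V}) := (enum_rank s < enum_rank (t @: s))%N.
exists [ffun s => if lt_orbit s then c s else 0].
  by apply/chainsP => s; rewrite ffunE; case: ifP; rewrite ?eqxx// => _; exact: cK.
apply/ffunP => s; rewrite ffunE pushforward_invE !ffunE /lt_orbit imset_invK.
rewrite -pushforward_invE ct.
have [->|cs] := eqVneq (c s) 0; first by rewrite !if_same addr0.
have [sK _] := cK _ cs.
case: ltngtP => [||/val_inj/enum_rank_inj st]; rewrite ?addr0 ?add0r//.
have /set0Pn[v vs] : s != finset.set0 by case: Kt => _ + _ _ _; exact.
have : t v \notin s by case: Kt => _ _ _ _; apply.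
by rewrite st imset_f.
Qed.

Lemma half_inv_chains m d : d \in chains K m -> d + pushforward t d \in inv_chains K t m.
Proof.
move=> dK; rewrite inE !(boundaryD, pushforwardD) pushforward_invK addrC eqxx andbT.
by apply: chainsD => //; exact: pushforward_chains dK Kinv.
Qed.

Lemma halfP m c : c \in inv_chains K t m ->
  Defs.half K t m c \in chains K m /\ c = Defs.half K t m c + pushforward t (Defs.half K t m c).
Proof.
move=> /inv_chains_half[d dK cE]; rewrite /Defs.half; case: pickP => [e /andP[eK /eqP]//|].
by move=> /(_ d); rewrite dK -cE eqxx.
Qed.

Definition half_nu m d : 'F_2 :=
  if m is m'.+1 then nu K t m' (boundary d) else \sum_s d s.

Lemma nuE m c : nu K t m c = half_nu m (Defs.half K t m c).
Proof. by case: m. Qed.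

Lemma sum_pushforward_inv c : \sum_s pushforward t c s = \sum_s c s.
Proof.
have tI : injective (fun s : {set V} => t @: s) by exact: inv_inj imset_invK.
rewrite (reindex_inj tI)/=; apply: eq_bigr => s _.
by rewrite pushforward_invE imset_invK.
Qed.

Lemma sum_boundary c : c \in chains K 1 -> \sum_s boundary c s = 0.
Proof.
move: c; apply: (chains_ind (@enum_list V)) => [|c d c0 d0|s sK].
- by rewrite raddf0 big1// => s _; rewrite ffunE.
- rewrite !(boundaryD, pushforwardD); under eq_bigr do rewrite ffunE.
  by rewrite big_split/= c0 d0 addr0.
rewrite boundary_sym cardE; have := enum_uniq s.
case: (enum _) => [//|a [//|b []//]] /= _ _; rewrite addr0.
under eq_bigr do rewrite ffunE.
by rewrite big_split/= !sum_sym1 addF2.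
Qed.

Lemma boundary_push_half m d : d \in chains K m ->
  boundary (d + pushforward t d) = boundary d + pushforward t (boundary d).
Proof. by move=> dK; rewrite !(boundaryD, pushforwardD) (boundary_pushforward _ dK). Qed.

Lemma addcc_eq c d : c + d = 0 -> d = c.
Proof. by move=> cd; rewrite -(add0r d) -(addcc c) -addrA cd addr0. Qed.

Lemma boundary_half m d : d \in chains K m.+1 ->
  boundary (d + pushforward t d) = 0 -> boundary d \in inv_cycles K t m.
Proof.
move=> dK; rewrite (boundary_push_half dK) => /addcc_eq d0.
rewrite inE (boundary_boundary dK) eqxx andbT inE d0 eqxx andbT.
exact: boundary_chains dK.
Qed.

Lemma inv_cyclesP m c : c \in inv_cycles K t m -> c \in inv_chains K t m /\ boundary c = 0.
Proof. by rewrite inE => /andP[-> /eqP]. Qed.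

Lemma half_diff m d d' : d \in chains K m -> d' \in chains K m ->
  d + pushforward t d = d' + pushforward t d' -> d + d' \in inv_chains K t m.
Proof.
move=> dK d'K dd'; rewrite inE chainsD// !(boundaryD, pushforwardD); apply/eqP.
rewrite -[d in RHS](addcK _ (pushforward t d)) dd' [RHS]addrC !addrA addcc add0r.
exact: addrC.
Qed.

(** In degree 0 an edge has two ends; in higher degrees a boundary has no boundary. *)
Lemma half_nuD_boundary m h f : f \in chains K m.+1 ->
  half_nu m (h + boundary f) = half_nu m h.
Proof.
case: m => [|m] fK /=; last by rewrite !(boundaryD, pushforwardD) (boundary_boundary fK) addr0.
by under eq_bigr do rewrite ffunE; rewrite big_split/= (sum_boundary fK) addr0.
Qed.

(* d is determined by d + T(d) up to an invariant chain f + T(f), and changing d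
   by f + T(f) changes the half of its boundary by the boundary of f. *)
Lemma half_nu_uniq m d d' : d \in chains K m -> d' \in chains K m ->
  d + pushforward t d = d' + pushforward t d' -> boundary (d + pushforward t d) = 0 ->
  half_nu m d = half_nu m d'.
Proof.
elim: m d d' => [|m IH] d d' dK d'K dd' bd0.
all: have [f fK fE] := inv_chains_half (half_diff dK d'K dd').
all: have d'E : d' = d + (f + pushforward t f) by rewrite -fE addrA addcc add0r.
  rewrite d'E /=; under [RHS]eq_bigr => s _ do rewrite [_ s]ffunE [X in _ + X]ffunE.
  by rewrite !big_split/= sum_pushforward_inv addF2 addr0.
have dcyc := boundary_half dK bd0; have [dinv bbd] := inv_cyclesP dcyc.
have d'cyc : boundary d' \in inv_cycles K t m by apply: boundary_half => //; rewrite -dd'.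
have [d'inv bbd'] := inv_cyclesP d'cyc.
have [hK hE] := halfP dinv; have [h'K h'E] := halfP d'inv.
have bfK := boundary_chains Kdown fK.
rewrite /= !nuE -(half_nuD_boundary (Defs.half K t m (boundary d)) fK).
have hfE : Defs.half K t m (boundary d) + boundary f +
    pushforward t (Defs.half K t m (boundary d) + boundary f) = boundary d'.
  rewrite pushforwardD addrACA -hE d'E !boundaryD.
  by rewrite (boundary_pushforward _ fK).
by apply: IH => //; rewrite ?hfE ?chainsD.
Qed.

(** The rule by which indices are computed later: any half at hand can be used. *)
Lemma nu_half m d : d \in chains K m -> boundary (d + pushforward t d) = 0 ->
  nu K t m (d + pushforward t d) = half_nu m d.
Proof.
move=> dK d0; have [hK hE] := halfP (half_inv_chains dK).
by rewrite nuE; apply: half_nu_uniq => //; rewrite -hE.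
Qed.

Lemma inv_chainsD m c d : c \in inv_chains K t m -> d \in inv_chains K t m ->
  c + d \in inv_chains K t m.
Proof.
rewrite [c \in _]inE [d \in _]inE [_ + _ \in _]inE => /andP[cK /eqP ct] /andP[dK /eqP dt].
by rewrite chainsD// !(boundaryD, pushforwardD) ct dt eqxx.
Qed.

Lemma inv_cyclesD m z z' : z \in inv_cycles K t m -> z' \in inv_cycles K t m ->
  z + z' \in inv_cycles K t m.
Proof.
move=> /inv_cyclesP[zi z0] /inv_cyclesP[z'i z'0].
by rewrite inE inv_chainsD// !(boundaryD, pushforwardD) z0 z'0 addr0 eqxx.
Qed.

Lemma nuD m z z' : z \in inv_cycles K t m -> z' \in inv_cycles K t m ->
  nu K t m (z + z') = nu K t m z + nu K t m z'.
Proof.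
elim: m z z' => [|m IH] z z' zc z'c.
all: have [zi z0] := inv_cyclesP zc; have [z'i z'0] := inv_cyclesP z'c.
all: have [hK hE] := halfP zi; have [h'K h'E] := halfP z'i.
all: set h := Defs.half K t _ z in hK hE; set h' := Defs.half K t _ z' in h'K h'E.
all: have hhE : z + z' = (h + h') + pushforward t (h + h') by
  rewrite !(boundaryD, pushforwardD) addrACA -hE -h'E.
all: rewrite hhE nu_half ?chainsD -?hhE ?boundaryD ?z0 ?z'0 ?addr0//.
  by rewrite /=; under eq_bigr do rewrite ffunE; rewrite big_split.
by rewrite /= boundaryD IH//; apply: boundary_half => //; rewrite -?hE -?h'E.
Qed.

Lemma inv_boundary_half m b : b \in inv_chains K t m.+1 -> exists2 f,
  f \in chains K m.+1 & boundary b = boundary f + pushforward t (boundary f).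
Proof.
move=> /inv_chains_half[f fK ->]; exists f => //; exact: boundary_push_half fK.
Qed.

Lemma boundary_inv_cycles m b : b \in inv_chains K t m.+1 -> boundary b \in inv_cycles K t m.
Proof.
move=> bi; have [f fK bE] := inv_boundary_half bi; have [h hK hE] := inv_chains_half bi.
rewrite inE bE half_inv_chains ?(boundary_chains Kdown fK)//= -bE.
have bK : b \in chains K m.+1 by move: bi; rewrite inE => /andP[].
by rewrite (boundary_boundary bK).
Qed.

(** If [b = f + T(f)], then [boundary f] is a half of [boundary b], and adding a boundary to a half
    does not change [half_nu]. *)
Lemma nu_boundary m z b : z \in inv_cycles K t m -> b \in inv_chains K t m.+1 ->
  nu K t m (z + boundary b) = nu K t m z.
Proof.
move=> zc bi; have [f fK bE] := inv_boundary_half bi.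
have [zi z0] := inv_cyclesP zc; have [hK hE] := halfP zi.
have bfK := boundary_chains Kdown fK.
set h := Defs.half K t m z in hK hE.
have zbE : z + boundary b = (h + boundary f) + pushforward t (h + boundary f).
  by rewrite !(boundaryD, pushforwardD) addrACA -hE -bE.
have [_ zb0] := inv_cyclesP (inv_cyclesD zc (boundary_inv_cycles bi)).
rewrite zbE nu_half ?chainsD -?zbE//.
by rewrite half_nuD_boundary// [in RHS]nuE.
Qed.

Lemma inv_cycles0 m : 0 \in inv_cycles K t m.
Proof.
by rewrite !inE !raddf0 !eqxx !andbT; apply/forallP => s; rewrite ffunE eqxx.
Qed.

Lemma nu0 m : nu K t m 0 = 0.
Proof.
have /(nuD (inv_cycles0 m)) := inv_cycles0 m.
by rewrite addr0 addF2.
Qed.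

Lemma inv_boundaries0 m : 0 \in inv_boundaries K t m.
Proof.
by apply/imsetP; exists 0; rewrite ?raddf0//; have := inv_cycles0 m.+1; rewrite inE => /andP[].
Qed.

Lemma homology_class_refl m z : z \in homology_class K t m z.
Proof. by apply/imsetP; exists 0; rewrite ?inv_boundaries0// addr0. Qed.

Lemma homology_class_eq m z b : b \in inv_boundaries K t m ->
  homology_class K t m (z + b) = homology_class K t m z.
Proof.
move=> /imsetP[b' b'i ->]; apply/setP => y; apply/imsetP/imsetP => -[_ /imsetP[a ai ->] ->].
  exists (boundary (b' + a)); last by rewrite boundaryD addrA.
  by apply: imset_f; exact: inv_chainsD.
exists (boundary (b' + a)); last by rewrite !(boundaryD, pushforwardD) !addrA addcK.
by apply: imset_f; exact: inv_chainsD.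
Qed.

Lemma class_nu_class m z : z \in inv_cycles K t m ->
  class_nu K t m (homology_class K t m z) = nu K t m z.
Proof.
move=> zc; rewrite /class_nu; case: pickP => /= [y|/(_ z)]; last by rewrite homology_class_refl.
by move=> /imsetP[_ /imsetP[b bi ->] ->]; exact: nu_boundary.
Qed.

End Involution.

Definition equivariant_map (V W : finType) (K : {set {set V}}) (t : V -> V)
    (K' : {set {set W}}) (t' : W -> W) (f : V -> W) : Prop :=
  (forall s, s \in K -> f @: s \in K') /\
  (forall s v, s \in K -> v \in s -> f (t v) = t' (f v)).

Section Equivariant.
Variables (V W : finType) (K : {set {set V}}) (t : V -> V).
Variables (K' : {set {set W}}) (t' : W -> W) (f : V -> W).
Hypotheses (Kt : free_complex K t) (Kt' : free_complex K' t').
Hypothesis ft : equivariant_map K t K' t' f.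

Lemma pushforward_equivariant m c : c \in chains K m ->
  pushforward f (pushforward t c) = pushforward t' (pushforward f c).
Proof.
move=> cK; rewrite (pushforward_comp _ _ cK) (pushforward_comp _ _ cK).
by apply: (eq_pushforward cK) => s v; case: ft => _; exact.
Qed.

Lemma pushforward_inv_chains m c : c \in inv_chains K t m ->
  pushforward f c \in inv_chains K' t' m.
Proof.
rewrite inE => /andP[cK /eqP ct]; rewrite inE (pushforward_chains cK ft.1)/=.
by rewrite -(pushforward_equivariant cK) ct.
Qed.

Lemma inv_chains_chains m c : c \in inv_chains K t m -> c \in chains K m.
Proof. by rewrite inE => /andP[]. Qed.

Lemma pushforward_inv_cycles m c : c \in inv_cycles K t m ->
  pushforward f c \in inv_cycles K' t' m.
Proof.
move=> /inv_cyclesP[ci c0]; rewrite inE pushforward_inv_chains//=.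
by rewrite (boundary_pushforward _ (inv_chains_chains ci)) c0 raddf0.
Qed.

(** The image of a half is a half of the image, which reduces the degree; in degree 0 vertices go to
    vertices, so their number keeps its parity. *)
Lemma nu_pushforward m c : c \in inv_cycles K t m ->
  nu K' t' m (pushforward f c) = nu K t m c.
Proof.
elim: m c => [|m IH] c cc; have [ci c0] := inv_cyclesP cc.
all: have [hK hE] := halfP Kt ci; set h := Defs.half K t _ c in hK hE.
all: have fE : pushforward f c = pushforward f h + pushforward t' (pushforward f h) by
  rewrite -(pushforward_equivariant hK) -pushforwardD -hE.
all: have [_ fc0] := inv_cyclesP (pushforward_inv_cycles cc).
all: rewrite fE (nu_half Kt') -?fE ?(pushforward_chains hK ft.1)// [RHS]nuE -/h /=.
  move: hK; move: h {hE fE}; apply: (chains_ind (@enum_list V)) => [|c1 c2 h1 h2|s sK cs].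
  - by rewrite raddf0 !big1// => s _; rewrite ffunE.
  - rewrite pushforwardD; under eq_bigr do rewrite ffunE.
    by under [RHS]eq_bigr do rewrite ffunE; rewrite !big_split/= h1 h2.
  rewrite pushforward_sym; move: cs; rewrite cardE.
  by case: (enum s) => [//|a [|//]] _; rewrite !sum_sym1.
rewrite (boundary_pushforward _ hK) IH//.
by apply: (boundary_half Kt) => //; rewrite -hE.
Qed.

End Equivariant.

(** * Contiguous maps are homologous *)

Section Prism.
Variables (P Q : Type) (M : zmodType) (p q : P -> Q).

(** The usual triangulation of a prism, with simplices [p v_0, ..., p v_i, q v_i, ..., q v_k]. *)
Fixpoint prism (G : seq Q -> M) (x : seq P) : M :=
  if x is v :: x' then G (p v :: q v :: map q x') + prism (fun y => G (p v :: y)) x'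
  else 0.

Lemma prismD (G G' : seq Q -> M) x :
  prism (fun y => G y + G' y) x = prism G x + prism G' x.
Proof. by elim: x G G' => [|v x IH] G G' /=; rewrite ?addr0// IH addrACA. Qed.

(** The homotopy formula. Walls between consecutive simplices of the prism occur twice and cancel;
    the two ends and the prism over the boundary, [dl (prism G)], remain. *)
Lemma dl_prism (G : seq Q -> M) x : (forall a : M, a + a = 0) ->
  prism (dl G) x = G (map q x) + G (map p x) + dl (prism G) x.
Proof.
move=> M2; elim: x G => [|v x IH] G /=; first by rewrite M2 addr0.
rewrite prismD IH !dlD dl_map.
by rewrite !addrA (ACl ((2*5)*((1*6)*(4*(3*7))))%AC)/= M2 add0r !addrA.
Qed.

Lemma prism_closed (S : M -> Prop) : S 0 -> (forall a b, S a -> S b -> S (a + b)) ->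
  forall x (G : seq Q -> M),
  (forall x1 v x2, x = x1 ++ v :: x2 -> S (G (map p x1 ++ p v :: q v :: map q x2))) ->
  S (prism G x).
Proof.
move=> S0 SD; elim=> //= v x IH G SG; apply: SD; first exact: (SG [::] v x).
by apply: IH => x1 w x2 xE; apply: (SG (v :: x1) w x2); rewrite xE.
Qed.

Lemma eq_prism (G G' : seq Q -> M) x :
  (forall x1 v x2, x = x1 ++ v :: x2 ->
     G (map p x1 ++ p v :: q v :: map q x2) = G' (map p x1 ++ p v :: q v :: map q x2)) ->
  prism G x = prism G' x.
Proof.
elim: x G G' => //= v x IH G G' GG'; congr (_ + _); first exact: (GG' [::] v x).
by apply: IH => x1 w x2 xE; apply: (GG' (v :: x1) w x2); rewrite xE.
Qed.

End Prism.

Lemma prism_add P Q (M M' : zmodType) (h : {additive M -> M'}) (p q : P -> Q)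
    (G : seq Q -> M) x :
  h (prism p q G x) = prism p q (fun z => h (G z)) x.
Proof. by elim: x G => [|v x IH] G /=; rewrite ?raddf0// raddfD IH. Qed.

Lemma prism_map P P' Q (M : zmodType) (f : P' -> P) (p q : P -> Q) (G : seq Q -> M) x :
  prism p q G (map f x) = prism (p \o f) (q \o f) G x.
Proof. by elim: x G => //= v x IH G; rewrite IH -map_comp. Qed.

Lemma prism_comp P Q Q' (M : zmodType) (f : Q -> Q') (p q : P -> Q) (G : seq Q' -> M) x :
  prism p q (fun y => G (map f y)) x = prism (f \o p) (f \o q) G x.
Proof.
by elim: x G => //= v x IH G; rewrite (IH (fun y => G (f (p v) :: y))) -map_comp.
Qed.

Lemma eq_in_prism (P : eqType) Q (M : zmodType) (p q p' q' : P -> Q) (G : seq Q -> M) x :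
  {in x, p =1 p'} -> {in x, q =1 q'} -> prism p q G x = prism p' q' G x.
Proof.
elim: x G => //= v x IH G pp qq; rewrite pp ?qq ?mem_head//.
have sx w : w \in x -> w \in v :: x by rewrite inE => ->; rewrite orbT.
rewrite IH => [|w /sx|w /sx]; [|exact: pp|exact: qq].
by congr (G (_ :: _ :: _) + _); apply/eq_in_map => w /sx; exact: qq.
Qed.

Section Contiguity.
Variables (V W : finType) (K : {set {set V}}) (t : V -> V).
Variables (K' : {set {set W}}) (t' : W -> W) (p q : V -> W).
Hypotheses (Kt : free_complex K t) (Kt' : free_complex K' t').
Hypotheses (pt : equivariant_map K t K' t' p) (qt : equivariant_map K t K' t' q).
Hypothesis pq : forall s, s \in K -> p @: s :|: q @: s \in K'.

(* A T-invariant vertex ranking that is injective on simplices: the orders which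
   it induces on simplices make the prism operator commute with T. *)
Definition orbit_rank (v : V) : nat := minn (enum_rank v) (enum_rank (t v)).

Lemma orbit_rankT v : orbit_rank (t v) = orbit_rank v.
Proof. by rewrite /orbit_rank; case: Kt => -> *; rewrite minnC. Qed.

Lemma orbit_rank_inj s v w : s \in K -> v \in s -> w \in s ->
  orbit_rank v = orbit_rank w -> v = w.
Proof.
case: Kt => tK _ _ _ fK sK vs ws.
have tvw : t v != w by apply: contraNneq (fK _ _ sK vs) => ->.
have vtw : v != t w by apply: contraNneq (fK _ _ sK ws) => <-.
have rI (a b : V) : enum_rank a = enum_rank b :> nat -> a = b by move=> /val_inj/enum_rank_inj.
rewrite /orbit_rank; case: (leqP (enum_rank v) (enum_rank (t v))) => _;
  case: (leqP (enum_rank w) (enum_rank (t w))) => _ /rI // vw.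
- by rewrite vw eqxx in vtw.
- by rewrite vw eqxx in tvw.
- by rewrite -[v]tK vw tK.
Qed.

Definition orbit_le : rel V := relpre orbit_rank leq.

Definition orbit_list (s : {set V}) : seq V := sort orbit_le (enum s).

Lemma orbit_listE s : uniq (orbit_list s) /\ [set y in orbit_list s] = s.
Proof.
rewrite sort_uniq enum_uniq; split=> //; apply/setP => y.
by rewrite inE mem_sort mem_enum.
Qed.

(** [orbit_rank] is injective on a simplex, so its sorted listing is unique. Hence the faces of a
    listed simplex, and its image under [t], are listed in the inherited order. *)
Lemma orbit_list_unique x : uniq x -> [set y in x] \in K -> sorted orbit_le x ->
  orbit_list [set y in x] = x.
Proof.
move=> ux xK sx; set s := [set y in x].
have mem y : (y \in s) = (y \in x) by rewrite inE.
have pe : perm_eq (orbit_list s) x.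
  apply: uniq_perm => //; first by case: (orbit_listE s).
  by move=> y; rewrite mem_sort mem_enum mem.
apply: (sorted_eq_in _ _ _ sx pe).
- by move=> a b c _ _ _; exact: leq_trans.
- move=> a b; rewrite mem_sort mem_enum => aS.
  rewrite mem_sort mem_enum => bS /anti_leq; exact: orbit_rank_inj xK aS bS.
- by apply: sort_sorted => a b; exact: leq_total.
Qed.

Definition F2_scale (M : zmodType) (a : 'F_2) (m : M) : M := if a == 0 then 0 else m.

Lemma F2_scaleD (a b : 'F_2) (c : chain W) :
  F2_scale (a + b) c = F2_scale a c + F2_scale b c.
Proof.
rewrite /F2_scale; have [->|/F2_neq0 ->] := eqVneq a 0; first by rewrite !add0r.
have [->|/F2_neq0 ->] := eqVneq b 0; first by rewrite !addr0.
by rewrite addF2 eqxx addcc.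
Qed.

Definition prism_op (c : chain V) : chain W :=
  \sum_s F2_scale (c s) (prism p q (@sym W) (orbit_list s)).

Lemma prism_op_is_zmod_morphism : zmod_morphism prism_op.
Proof.
have opp (X : finType) (e : chain X) : - e = e.
  by apply/eqP; rewrite eq_sym -addr_eq0 addcc.
move=> c d; rewrite !opp -big_split; apply: eq_bigr => s _.
by rewrite ffunE F2_scaleD.
Qed.
HB.instance Definition _ := GRing.isZmodMorphism.Build (chain V) (chain W)
  prism_op prism_op_is_zmod_morphism.

Lemma prism_op_sym x : sorted orbit_le x -> (x != [::] -> [set y in x] \in K) ->
  uniq x -> prism_op (sym x) = prism p q (@sym W) x.
Proof.
have [->|x0] := eqVneq x [::]; first by rewrite sym_nil raddf0.
move=> sx /(_ isT) xK ux; rewrite /prism_op (bigD1 [set y in x])//= symE// eqxx.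
rewrite big1 ?addr0 => [|s /negbTE sx']; last by rewrite symE// sx' /F2_scale eqxx.
by rewrite /F2_scale oner_eq0 orbit_list_unique.
Qed.

Lemma boundary_prism_op m c : c \in chains K m ->
  boundary (prism_op c) = pushforward q c + pushforward p c + prism_op (boundary c).
Proof.
move: c; apply: (chains_ind orbit_listE) => [|c d cE dE|s sK cs].
- by rewrite !raddf0 !addr0.
- rewrite !raddfD/= cE dE.
  by rewrite !addrA (ACl ((1*4)*(2*5)*(3*6))%AC)/= -!addrA.
have [us sE] := orbit_listE s.
have ss : sorted orbit_le (orbit_list s) by apply: sort_sorted => a b; exact: leq_total.
rewrite prism_op_sym ?sE// prism_add/= (eq_prism (G' := dl (@sym W))); last first.
  by move=> *; exact: boundary_sym.
rewrite dl_prism; last exact: addcc.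
rewrite !pushforward_sym boundary_sym dl_add; congr (_ + _).
apply: eq_dl => z zs /=; have subz := face_subseq zs.
rewrite prism_op_sym ?(subseq_uniq subz)//.
  by apply: subseq_sorted subz ss => a b c; exact: leq_trans.
move=> z0; case: Kt => _ _ Kd _ _; apply: (Kd s) => //.
  by rewrite -sE; apply/fintype.subsetP => y; rewrite !inE; exact: mem_subseq.
by case: (z) z0 => // a z' _; apply/set0Pn; exists a; rewrite inE mem_head.
Qed.

Lemma prism_op_chains m c : c \in chains K m -> prism_op c \in chains K' m.+1.
Proof.
move: c; apply: (chains_ind orbit_listE) => [|c d cE dE|s sK cs].
- by rewrite raddf0 chains0.
- by rewrite raddfD; exact: chainsD.
have [us sE] := orbit_listE s.
have ss : sorted orbit_le (orbit_list s) by apply: sort_sorted => a b; exact: leq_total.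
rewrite prism_op_sym ?sE//.
apply: (prism_closed (S := fun e => e \in chains K' m.+1)); first exact: chains0.
  exact: chainsD.
move=> x1 v x2 xE; apply: sym_chains.
  rewrite size_cat/= !size_map addnS; congr _.+1.
  by rewrite -cs -[s in RHS]sE cardsE (card_uniqP us) xE size_cat.
case: Kt' => _ _ Kd _ _; apply: (Kd _ _ (pq sK)).
  have xs y : y \in x1 ++ v :: x2 -> y \in s by rewrite -xE -[in X in _ -> X]sE inE.
  apply/fintype.subsetP => w; rewrite !inE mem_cat !inE.
  move=> /orP[/mapP[y yx ->]|/predU1P[->|/predU1P[->|/mapP[y yx ->]]]].
  - by rewrite imset_f ?xs// mem_cat yx.
  - by rewrite imset_f ?xs// mem_cat mem_head orbT.
  - by rewrite (imset_f q) ?orbT ?xs// mem_cat mem_head orbT.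
  - by rewrite (imset_f q) ?orbT ?xs// mem_cat inE yx !orbT.
by apply/set0Pn; exists (p v); rewrite inE mem_cat mem_head orbT.
Qed.

Lemma prism_op_equivariant m c : c \in chains K m ->
  pushforward t' (prism_op c) = prism_op (pushforward t c).
Proof.
move: c; apply: (chains_ind orbit_listE) => [|c d cE dE|s sK cs].
- by rewrite !raddf0.
- by rewrite !raddfD/= cE dE.
have [us sE] := orbit_listE s; have [tK _ _ tKK _] := Kt.
have ss : sorted orbit_le (orbit_list s) by apply: sort_sorted => a b; exact: leq_total.
have tsE : [set y in map t (orbit_list s)] = t @: s.
  apply/setP => w; rewrite inE; apply/mapP/imsetP => -[v vs ->]; exists v => //.
    by rewrite -sE inE.
  by rewrite -sE inE in vs.
rewrite pushforward_sym !prism_op_sym ?sE ?tsE ?tKK ?(map_inj_uniq (inv_inj tK))//; last first.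
  rewrite sorted_map; apply: sub_sorted ss => a b.
  by rewrite /orbit_le /= !orbit_rankT.
rewrite prism_add/= prism_map.
rewrite (eq_prism (G' := fun y => sym (map t' y))) => [|*]; last by rewrite pushforward_sym.
rewrite prism_comp; apply: eq_in_prism => v; rewrite mem_sort mem_enum => vs /=.
  by case: pt => _ pE; rewrite (pE s).
by case: qt => _ qE; rewrite (qE s).
Qed.

Lemma contiguous_homologous m z : z \in inv_cycles K t m ->
  exists2 b, b \in inv_boundaries K' t' m & pushforward q z = pushforward p z + b.
Proof.
move=> /inv_cyclesP[zi z0]; have zK := inv_chains_chains zi.
exists (boundary (prism_op z)).
  apply: imset_f; rewrite inE prism_op_chains//= (prism_op_equivariant zK).
  by move: zi; rewrite inE => /andP[_ /eqP ->].
rewrite (boundary_prism_op zK) z0 raddf0 addr0.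
by rewrite [RHS]addrC addcK.
Qed.

End Contiguity.

(** * Nerves and the inverse limit *)

Section Nerve.
Variable X : tspace.
Implicit Types (A B C : tcover X).

Lemma tinv_imageE (U : set X) x : (tinv @` U)%classic x <-> U (tinv x).
Proof.
split=> [[y Uy <-]|Ux]; first by rewrite tinvK.
by exists (tinv x); rewrite ?tinvK.
Qed.

Lemma tinv_imageK (U : set X) : (tinv @` (tinv @` U) = U)%classic.
Proof. by apply/seteqP; split=> x; rewrite !tinv_imageE tinvK. Qed.

Lemma tinv_image_open (U : set X) : open U -> open (tinv @` U)%classic.
Proof.
move=> oU; rewrite (_ : (tinv @` U)%classic = (tinv @^-1` U)%classic).
  by apply: open_comp => // x _; exact: tinv_continuous.
by apply/seteqP; split=> x; rewrite tinv_imageE.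
Qed.

Lemma tactK A : involutive (@tact X A).
Proof. by move=> U; apply: val_inj; exact: tinv_imageK. Qed.

Lemma tcover_disjoint A (U : A) x : fsval U x -> ~ fsval U (tinv x).
Proof.
move=> Ux Utx; have := tcover_disj (valP U).
by rewrite -subset0 => /(_ x); apply; split => //; exact/tinv_imageE.
Qed.

Lemma nerveP A (s : {set A}) : s \in nerve A <->
  s != finset.set0 /\ exists x : X, forall U : A, U \in s -> fsval U x.
Proof.
rewrite inE; split=> [/andP[-> /asboolP]//|[-> H]].
by apply/andP; split => //; exact/asboolP.
Qed.

Lemma nerve_free A : free_complex (nerve A) (@tact X A).
Proof.
split; first exact: tactK.
- by move=> s /nerveP[].
- move=> s u /nerveP[s0 [x sx]] us u0; apply/nerveP; split => //; exists x => U Uu.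
  by apply: sx; exact: (fintype.subsetP us).
- move=> s /nerveP[s0 [x sx]]; apply/nerveP; split.
    by have [U Us] := set0Pn _ s0; apply/set0Pn; exists (tact U); exact: imset_f.
  exists (tinv x) => _ /imsetP[U Us ->] /=; apply/tinv_imageE; rewrite tinvK; exact: sx.
- move=> s U /nerveP[_ [x sx]] Us; apply/negP => /sx /= /tinv_imageE.
  exact: tcover_disjoint (sx _ Us).
Qed.

Lemma projection_equivariant A B (p : B -> A) : is_projection p ->
  equivariant_map (nerve B) (@tact X B) (nerve A) (@tact X A) p.
Proof.
move=> pp; split=> [s /nerveP[s0 [x sx]]|s U /nerveP[s0 [x sx]] Us].
  apply/nerveP; split.
    by have [U Us] := set0Pn _ s0; apply/set0Pn; exists (p U); exact: imset_f.
  exists x => _ /imsetP[U Us ->]; have Ux := sx _ Us.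
  by have [|+ _] := pp U; [exists x|exact].
by have [] := pp U (ex_intro _ x (sx _ Us)).
Qed.

Lemma projections_contiguous A B (p q : B -> A) s : is_projection p -> is_projection q ->
  s \in nerve B -> p @: s :|: q @: s \in nerve A.
Proof.
move=> pp qq /nerveP[s0 [x sx]]; apply/nerveP; split.
  by have [U Us] := set0Pn _ s0; apply/set0Pn; exists (p U); rewrite inE imset_f.
exists x => U; rewrite inE => /orP[] /imsetP[W Ws ->].
  by have [|+ _] := pp W; [exists x; exact: sx|apply; exact: sx].
by have [|+ _] := qq W; [exists x; exact: sx|apply; exact: sx].
Qed.

Lemma is_projection_comp A B C (p : B -> A) (q : C -> B) :
  is_projection p -> is_projection q -> is_projection (p \o q).
Proof.
move=> pp qq U [x Ux]; have [Uq qt] := qq U (ex_intro _ x Ux).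
have [Vp pt] := pp (q U) (ex_intro _ x (Uq _ Ux)).
by split=> [y /Uq /Vp//|/=]; rewrite qt pt.
Qed.

Lemma is_projection_id A : is_projection (@id A).
Proof. by move=> U _; split. Qed.

(* T acts freely on the nonempty members, so the images can be chosen on one
   member of each orbit. *)
Lemma exists_projection A B (x0 : X) :
  (forall U : B, (fsval U !=set0)%classic -> exists V : A, (fsval U `<=` fsval V)%classic) ->
  exists p : B -> A, is_projection p.
Proof.
move=> BA; have [V0 V0A _] := tcover_cover A x0.
have /choice[f fE] : forall U : B, exists V : A,
    (fsval U !=set0)%classic -> (fsval U `<=` fsval V)%classic.
  by move=> U; have [/BA[V UV]|U0] := pselect (fsval U !=set0)%classic;
    [exists V|exists (FSetSub V0A)].
exists (fun U => if (enum_rank U < enum_rank (tact U))%N then f U else tact (f (tact U))).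
move=> U [x Ux]; rewrite tactK; split.
  case: ifP => _; first by apply: fE; exists x.
  move=> y Uy; apply/tinv_imageE; apply: fE; last by apply/tinv_imageE; rewrite tinvK.
  by exists (tinv x); apply/tinv_imageE; rewrite tinvK.
case: ltngtP => [||/val_inj/enum_rank_inj UE] //; first by rewrite tactK.
exfalso; apply: (tcover_disjoint Ux); rewrite -UE /=; apply/tinv_imageE.
by rewrite tinvK.
Qed.

Lemma homology_class_nerve_map A B (p : B -> A) m z : is_projection p ->
  z \in inv_cycles (nerve B) (@tact X B) m ->
  nerve_map p m (homology_class (nerve B) (@tact X B) m z) =
  homology_class (nerve A) (@tact X A) m (pushforward p z).
Proof.
move=> pp zc; have pe := projection_equivariant pp.
apply/setP => y; apply/imset2P/imsetP => [[_ b /imsetP[_ /imsetP[a ai ->] ->] bi ->]|[b bi ->]].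
  exists (boundary (pushforward p a) + b); last first.
    rewrite pushforwardD addrA; congr (_ + _ + _).
    by rewrite (boundary_pushforward _ (inv_chains_chains ai)).
  move: bi => /imsetP[b' b'i ->]; rewrite -boundaryD; apply: imset_f; apply: inv_chainsD b'i.
  exact: pushforward_inv_chains pe _ _ ai.
by exists z b => //; exact: homology_class_refl.
Qed.

Definition refines B A : Prop := exists p : B -> A, is_projection p.

(** Pairwise intersections of members serve as the refinement. This makes the sets of refinements of
    a cover a filter base. *)
Lemma common_refinement (x0 : X) A B : exists C, refines C A /\ refines C B.
Proof.
pose M := [fset (U `&` V)%classic | U in members A, V in members B]%fset.
have Mo U : U \in M -> open U.
  move=> /imfset2P[/= V VA [W WB ->]]; by apply: openI; [exact: tcover_open VA|exact: tcover_open WB].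
have Mc x : exists2 U, U \in M & U x.
  have [V VA Vx] := tcover_cover A x; have [W WB Wx] := tcover_cover B x.
  by exists (V `&` W)%classic => //; apply/imfset2P; exists V => //; exists W.
have Mi U : U \in M -> (tinv @` U)%classic \in M.
  move=> /imfset2P[/= V VA [W WB ->]].
  apply/imfset2P; exists (tinv @` V)%classic; first exact: tcover_inv.
  exists (tinv @` W)%classic; first exact: tcover_inv.
  by apply/seteqP; split=> x /=; [move/tinv_imageE=> [? ?]; split; exact/tinv_imageE|
    move=> [/tinv_imageE ? /tinv_imageE ?]; exact/tinv_imageE].
have Md U : U \in M -> (U `&` tinv @` U = set0)%classic.
  move=> /imfset2P[/= V VA [W WB ->]]; apply/seteqP; split => // x [[Vx _]].
  by move=> /tinv_imageE[Vtx _]; apply: (@tcover_disjoint A (FSetSub VA) x Vx).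
exists (TCover Mo Mc Mi Md); split; apply: (exists_projection x0) => U _;
  have /imfset2P[/= V VA [W WB UE]] := valP U.
  by exists (FSetSub VA) => /= x; rewrite UE => -[].
by exists (FSetSub WB) => /= x; rewrite UE => -[].
Qed.

(** Applied to the finitely many sets of chains of a nerve: along the ultrafilter, the image class
    in each nerve takes one value. *)
Lemma ultrafilter_finite (I : finType) (T : Type) (F : set_system T) (W : I -> set T) :
  UltraFilter F -> F (\bigcup_i W i)%classic -> exists i, F (W i).
Proof.
move=> FU FW; apply: contrapT => /forallNP nW.
have : F (fun x => forall i, (~` W i)%classic x).
  apply: filter_forall => i; case: (in_ultra_setVsetC (W i) FU) => // Wi.
  by case: (nW i).
move=> FnW; have [x [[i _ Wix] nWx]] := filter_ex (filterI FW FnW).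
exact: nWx Wix.
Qed.

(* A cycle of index 1 on each nerve is enough: the limit of their images along an
   ultrafilter of covers that refines every cover is a compatible family. *)
Lemma nu_nontrivial_nerves m (x0 : X) (A0 : tcover X) :
  (forall C, exists2 z, z \in inv_cycles (nerve C) (@tact X C) m &
                        nu (nerve C) (@tact X C) m z = 1) ->
  nu_nontrivial X m.
Proof.
move=> Hz.
have Hz' C : exists z : chain C,
    z \in inv_cycles (nerve C) (@tact X C) m /\ nu (nerve C) (@tact X C) m z = 1.
  by have [z zc z1] := Hz C; exists z.
pose z C := sval (cid (Hz' C)).
have zc C : z C \in inv_cycles (nerve C) (@tact X C) m by case: (svalP (cid (Hz' C))).
have z1 C : nu (nerve C) (@tact X C) m (z C) = 1 by case: (svalP (cid (Hz' C))).
pose F : set_system (tcover X) := fun W => exists A, forall C, refines C A -> W C.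
have refl A : refines A A by exists id; exact: is_projection_id.
have trans A B C : refines C B -> refines B A -> refines C A.
  by move=> [p pp] [q qq]; exists (q \o p); exact: is_projection_comp.
have FF : ProperFilter F.
  split; first by move=> [A /(_ A)]; apply; exact: refl.
  split; first by exists A0.
    move=> P Q [A AP] [B BQ]; have [C [CA CB]] := common_refinement x0 A B.
    by exists C => D DC; split; [apply/AP/(trans _ C)|apply/BQ/(trans _ C)].
  by move=> P Q PQ [A AP]; exists A => C /AP/PQ.
have [U [UU FU]] := ultraFilterLemma FF.
pose W A (h : {set chain A}) : set (tcover X) := fun C => exists2 p : C -> A,
  is_projection p & h = homology_class (nerve A) (@tact X A) m (pushforward p (z C)).
have hex A : exists h, U (W A h).
  apply: (ultrafilter_finite UU); apply: FU; exists A => C [p pp].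
  by exists (homology_class (nerve A) (@tact X A) m (pushforward p (z C))) => //; exists p.
pose h A := sval (cid (hex A)).
have hP A : U (W A (h A)) := svalP (cid (hex A)).
have pzc A C (p : C -> A) : is_projection p ->
    pushforward p (z C) \in inv_cycles (nerve A) (@tact X A) m.
  by move=> pp; apply: pushforward_inv_cycles (projection_equivariant pp) _ _ (zc C).
have hH A : h A \in nerve_homology A m.
  have [C [p pp ->]] := filter_ex (hP A).
  by apply: imset_f; exact: pzc.
have hc A B (p : B -> A) : is_projection p -> nerve_map p m (h B) = h A.
  (* One cover [C] realizes both classes. The two projections [p \o q] and [r] from [C] to [A] are
     contiguous, so the images of the cycle of [C] are homologous. *)
  move=> pp; have [C [[q qq ->] [r rr ->]]] := filter_ex (filterI (hP B) (hP A)).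
  rewrite homology_class_nerve_map ?pzc//.
  rewrite (pushforward_comp _ _ (inv_chains_chains (inv_cyclesP (zc C)).1)).
  have pq := is_projection_comp pp qq.
  have [b bi ->] := contiguous_homologous (nerve_free C) (nerve_free A)
    (projection_equivariant rr) (projection_equivariant pq)
    (fun s => @projections_contiguous A C r (p \o q) s rr pq) (zc C).
  exact: homology_class_eq.
exists (CechClass hH hc); rewrite /cech_nu.
have h1 A : class_nu (nerve A) (@tact X A) m (h A) = 1.
  have [C [p pp ->]] := filter_ex (hP A).
  rewrite (class_nu_class (nerve_free A) (pzc _ _ _ pp)) -(z1 C).
  exact: nu_pushforward (nerve_free C) (nerve_free A) (projection_equivariant pp) _ _ (zc C).
have /(xgetPex (0 : 'F_2)) : exists e : 'F_2, forall A,
  class_nu (nerve A) (@tact X A) m (h A) = e by exists 1.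
by move=> /(_ A0) /= <-; rewrite h1.
Qed.

Lemma nu_nontrivial_bound (A : tcover X) m : nu_nontrivial X m -> (m < #|A|)%N.
Proof.
move=> [h]; apply: contra_notT; rewrite -leqNgt => Am.
have ch0 m' (c : chain A) : (#|A| <= m')%N -> c \in chains (nerve A) m' -> c = 0.
  move=> Am' /chainsP cA; apply/ffunP => s; rewrite [RHS]ffunE.
  apply/eqP; apply: contraT => /cA[_ cs].
  by have := max_card (mem s); rewrite cs leqNgt ltnS Am'.
(* The default of [xget] is 0, as desired; only a genuine common value is left to examine. *)
rewrite /cech_nu; case: xgetP => // e _ /(_ A) <-.
have /imsetP[z zc ->] := cech_atP h A.
rewrite (class_nu_class (nerve_free A) zc).
have [/inv_chains_chains zA _] := inv_cyclesP zc.
by rewrite (ch0 _ _ Am zA) (nu0 (nerve_free A)).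
Qed.

(** If [P] and [Q] separate [x] from its image, then [P] intersected with the image of [Q] contains
    [x] and is disjoint from its own image. Compactness leaves finitely many such sets, to which
    their images are added. *)
Lemma exists_tcover : inhabited (tcover X).
Proof.
have sep x : exists U : set X, [/\ open U, U x & (U `&` tinv @` U = set0)%classic].
  have := @tspace_hausdorff X; rewrite open_hausdorff => /(_ x (tinv x)).
  have xtx : x != tinv x by apply/eqP => xE; exact: (tinv_free (esym xE)).
  move=> /(_ xtx)[[P Q]] /= [xP txQ] [oP oQ PQ].
  exists (P `&` tinv @` Q)%classic; split.
  - by apply: openI => //; exact: tinv_image_open.
  - by split; [exact/set_mem|apply/tinv_imageE/set_mem].
  - apply/seteqP; split => // y [[_ /tinv_imageE Qy] /tinv_imageE[Py _]].
    by have : (set0 : set X) (tinv y) by rewrite -(eqP PQ).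
have /choice[U UP] := sep.
have [D DX] : exists D : {fset X}, forall x, exists2 y, y \in D & U y x.
  (* Filter of the properties that hold for all sufficiently large finite sets of centres; the
     near-covering form of compactness then yields one set of centres for all points. *)
  pose F : set_system {fset X} := fun W =>
    exists D : {fset X}, forall D' : {fset X}, {subset D <= D'} -> W D'.
  have FF : Filter F.
    split; first by exists fset0.
      move=> P Q [D DP] [E EQ]; exists (D `|` E)%fset => D' DD'.
      by split; [apply: DP|apply: EQ] => y yD; apply: DD'; rewrite in_fsetU yD ?orbT.
    by move=> P Q PQ [D DP]; exists D => D' /DP/PQ.
  have /compact_near_coveringP cX := @tspace_compact X.
  have [|D /(_ D) DX] := cX _ F (fun D x => exists2 y, y \in D & U y x) FF.
    move=> x _; have [oU Ux _] := UP x.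
    exists (U x, [set D : {fset X} | x \in D]%classic); last by move=> [y D] [/= Uxy xD]; exists x.
    split; first exact: open_nbhs_nbhs.
    by exists [fset x]%fset => D' xD; apply: xD; rewrite in_fset1.
  by exists D => x; apply: DX.
pose M := ([fset U x | x in D] `|` [fset (tinv @` U x)%classic | x in D])%fset.
have MP V : V \in M -> exists x, V = U x \/ V = (tinv @` U x)%classic.
  rewrite in_fsetU => /orP[] /imfsetP[x _ ->]; exists x; by [left|right].
constructor; apply: (@TCover X M).
- by move=> V /MP[x [->|->]]; [|apply: tinv_image_open]; case: (UP x).
- move=> x; have [y yD Uyx] := DX x.
  by exists (U y) => //; rewrite in_fsetU; apply/orP; left; apply: in_imfset.
- move=> V; rewrite !in_fsetU => /orP[] /imfsetP[x xD ->]; apply/orP; [right|left].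
    exact: in_imfset.
  by rewrite tinv_imageK; exact: in_imfset.
- move=> V /MP[x [->|->]]; first by case: (UP x).
  rewrite tinv_imageK; have [_ _ <-] := UP x; exact: setIC.
Qed.

End Nerve.

(** * Subdivision *)

Section Subdivision.
Variables (P Q : Type) (M : zmodType) (b : seq P -> Q).

(* The subdivision of a simplex x is the cone with apex b x over the subdivision
   of its boundary. *)
Fixpoint sd_rec (k : nat) (G : seq Q -> M) (x : seq P) : M :=
  if k is k'.+1 then dl (sd_rec k' (fun y => G (b x :: y))) x else G [::].

Definition sd G x := sd_rec (size x) G x.

(** The simplices of the subdivision: complete flags of faces, listed by their apices from the
    largest face down. *)
Inductive sd_supp : seq P -> seq Q -> Prop :=
| sd_supp_nil : sd_supp [::] [::]
| sd_supp_cons x z y : face z x -> sd_supp z y -> sd_supp x (b x :: y).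

Lemma sd_recD k (G G' : seq Q -> M) x :
  sd_rec k (fun y => G y + G' y) x = sd_rec k G x + sd_rec k G' x.
Proof.
elim: k G G' x => //= k IH G G' x; rewrite -dlD; apply: eq_dl => z _; exact: IH.
Qed.

Lemma sdS G x : x <> [::] -> sd G x = dl (sd (fun y => G (b x :: y))) x.
Proof.
case: x => // v x _.
change (dl (sd_rec (size x) (fun y => G (b (v :: x) :: y))) (v :: x) =
        dl (sd (fun y => G (b (v :: x) :: y))) (v :: x)).
apply: eq_dl => z zx; by have [->] := face_size zx.
Qed.

Lemma sdD (G G' : seq Q -> M) x : sd (fun y => G y + G' y) x = sd G x + sd G' x.
Proof. exact: sd_recD. Qed.

(** Subdivision is a chain map, because the boundary of a cone is its base plus the cone over the
    boundary of the base. *)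
Lemma dl_sd G x : (forall a : M, a + a = 0) -> dl (sd G) x = sd (dl G) x.
Proof.
move=> M2; have [k] := ubnP (size x); elim: k x G => // k IH [|v x] G xk //.
rewrite [RHS]sdS//; pose G' y := G (b (v :: x) :: y).
(* The inserted term is [dl (dl (sd G'))], which vanishes. It matches the two parts of [dl G] on a
   cone: the base, with value [G y], and the cone over its boundary, with value [dl G' y]. *)
transitivity (dl (fun z => sd G z + dl (sd G') z) (v :: x)).
  by rewrite dlD [X in _ + X]dl_dl// addr0.
apply: eq_dl => z zx; rewrite IH; first by rewrite -sdD.
by move: xk; rewrite (face_size zx).
Qed.

End Subdivision.

(** Naturality of subdivision, which rests on the compatibility of the apices with [f] and [f'].
    [Good] limits this compatibility to simplices where it holds, for instance small ones. For
    membership statements the second side is ignored. *)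
Lemma sd_rel (P P' Q Q' : Type) (M M' : zmodType) (b : seq P -> Q) (b' : seq P' -> Q')
    (f : P -> P') (f' : Q -> Q') (Rel : M -> M' -> Prop) (Good : seq P -> Prop) :
  Rel 0 0 -> (forall a c a' c', Rel a a' -> Rel c c' -> Rel (a + c) (a' + c')) ->
  (forall x z, Good x -> face z x -> Good z) ->
  (forall x, Good x -> x <> [::] -> b' (map f x) = f' (b x)) ->
  forall (G : seq Q -> M) (G' : seq Q' -> M') x, Good x ->
  (forall y, sd_supp b x y -> Rel (G y) (G' (map f' y))) ->
  Rel (sd b G x) (sd b' G' (map f x)).
Proof.
move=> R0 RD Gf bf G G' x; have [k] := ubnP (size x).
elim: k x G G' => // k IH [|v x] G G' xk Gx GG'; first exact: (GG' [::] (sd_supp_nil b)).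
rewrite !sdS//; apply: dl_rel => // [a a' c c'|z zx]; first exact: RD.
apply: IH => [||y zy]; first by move: xk; rewrite (face_size zx).
  exact: Gf zx.
by rewrite bf//; apply: GG'; exact: sd_supp_cons zy.
Qed.

Lemma sd_supp_size P Q (b : seq P -> Q) x y : sd_supp b x y -> size y = size x.
Proof. by elim=> //= {}x z {}y /face_size -> _ ->. Qed.

Lemma sd_add P Q (M M' : zmodType) (h : {additive M -> M'}) (b : seq P -> Q)
    (G : seq Q -> M) x :
  h (sd b G x) = sd b (fun y => h (G y)) x.
Proof.
have := @sd_rel P P Q Q M M' b b id id (fun a a' => h a = a') (fun=> True).
move=> /(_ (raddf0 h) _ _ _ G (fun y => h (G y)) x I); rewrite map_id; apply=> //.
- by move=> a c a' c' <- <-; rewrite raddfD.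
- by move=> z _; rewrite map_id.
- by move=> y _; rewrite map_id.
Qed.

Lemma sd1 P Q (M : zmodType) (b : seq P -> Q) (G : seq Q -> M) v :
  sd b G [:: v] = G [:: b [:: v]].
Proof. by rewrite /sd /= addr0. Qed.

Lemma face_ex (P : eqType) (z x : seq P) : face z x -> exists v, v \in x.
Proof. by case=> v *; exists v; rewrite mem_head. Qed.

(** * Mesh of iterated barycentric subdivisions *)

Section Mesh.
Variables (R : realType) (V : normedModType R).
Implicit Types (x y : seq V).

Definition barycenter x : V := (size x)%:R^-1 *: \sum_(v <- x) v.

Lemma barycenter_linear (W : normedModType R) (f : {linear V -> W}) x :
  (size x)%:R^-1 *: \sum_(v <- map f x) v = f (barycenter x).
Proof. by rewrite big_map linearZ -(linear_sum f). Qed.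

(** The factor by which barycentric subdivision shrinks the diameter of an [m]-simplex. *)
Definition ratio (m : nat) : R := m%:R / m.+1%:R.

Lemma barycenter_dist x c M : x <> [::] -> (forall v, v \in x -> `|v - c| <= M) ->
  `|barycenter x - c| <= M.
Proof.
case: x => // v0 x0 _; set x := v0 :: x0 => xM.
have sx : (size x)%:R != 0 :> R by rewrite pnatr_eq0.
have -> : barycenter x - c = (size x)%:R^-1 *: \sum_(v <- x) (v - c).
  rewrite sumrB scalerBr big_const_seq count_predT iter_addr_0.
  by rewrite -(scaler_nat _ c) scalerA mulVf// scale1r.
rewrite normrZ normfV normr_nat mulrC ler_pdivrMr ?ltr0n//.
apply: (le_trans (ler_norm_sum _ _ _)).
rewrite mulr_natr -[X in M *+ X]count_predT -iter_addr_0 -big_const_seq.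
by rewrite big_seq [leRHS]big_seq; apply: ler_sum.
Qed.

(** The term of [v] itself vanishes, which leaves one term less than [size x], each of norm at most
    [d]; and [(s - 1) / s] increases with [s]. *)
Lemma barycenter_vertex_dist m x v d : (size x <= m.+1)%N -> v \in x ->
  (forall w, w \in x -> `|w - v| <= d) -> `|barycenter x - v| <= ratio m * d.
Proof.
move=> xm vx xd; have xn0 : x <> [::] by case: x vx {xm xd}.
have d0 : 0 <= d by apply: le_trans (xd _ vx).
have sx : (size x)%:R != 0 :> R by rewrite pnatr_eq0 size_eq0; exact/eqP.
have sx0 : 0 < (size x)%:R :> R by rewrite lt0r sx ler0n.
have -> : barycenter x - v = (size x)%:R^-1 *: \sum_(w <- rem v x) (w - v).
  rewrite -[X in _ *: X]add0r -{1}(subrr v).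
  rewrite -(big_cons _ _ v (rem v x) xpredT (fun w => w - v)).
  rewrite -(perm_big _ (perm_to_rem vx))/= sumrB scalerBr.
  rewrite big_const_seq count_predT iter_addr_0.
  by rewrite -(scaler_nat _ v) scalerA mulVf// scale1r.
rewrite normrZ normfV normr_nat.
apply: (@le_trans _ _ ((size x)%:R^-1 * ((size x).-1%:R * d))).
  rewrite ler_pM2l ?invr_gt0//; apply: (le_trans (ler_norm_sum _ _ _)).
  rewrite mulr_natl -(size_rem vx) -[X in d *+ X]count_predT -iter_addr_0 -big_const_seq.
  by rewrite big_seq [leRHS]big_seq; apply: ler_sum => w /mem_rem; exact: xd.
rewrite mulrA ler_wpM2r// mulrC /ratio ler_pdivrMr// mulrAC ler_pdivlMr ?ltr0n//.
rewrite -!natrM ler_nat; case: (size x) xm xn0 sx sx0 => [|s] /=; first by rewrite eqxx.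
by rewrite ltnS => sm _ _ _; rewrite !mulnS [(m * s)%N]mulnC leq_add2r.
Qed.

Lemma sd_supp_hull (C : V -> Prop) x y :
  (forall x, x <> [::] -> (forall v, v \in x -> C v) -> C (barycenter x)) ->
  sd_supp barycenter x y -> (forall v, v \in x -> C v) -> forall w, w \in y -> C w.
Proof.
move=> Cb; elim=> // {}x z {}y zx _ IH Cx w; rewrite inE => /predU1P[->|].
  by apply: Cb => // x0; move: zx; rewrite x0 => zx; inversion zx.
by apply: IH => v /(face_sub zx); exact: Cx.
Qed.

(** [C] stands for a convex set, used only through its stability under barycenters; [m] bounds the
    dimension and [d] the diameter. *)
Definition fine (C : V -> Prop) m d x := [/\ (size x <= m.+1)%N,
  forall v, v \in x -> C v & forall v w, v \in x -> w \in x -> `|v - w| <= d].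

Lemma fine_sub C m d x z : (size z <= size x)%N -> {subset z <= x} ->
  fine C m d x -> fine C m d z.
Proof.
move=> szx zx [xm xC xd]; split; first exact: leq_trans szx xm.
  by move=> v /zx; exact: xC.
by move=> v w /zx vx /zx wx; exact: xd.
Qed.

Lemma fine_face C m d x z : fine C m d x -> face z x -> fine C m d z.
Proof.
move=> xf zx; apply: fine_sub xf; last exact: face_sub.
by rewrite (face_size zx) leqnSn.
Qed.

Lemma sd_supp_fine C m d x y :
  (forall x, x <> [::] -> (forall v, v \in x -> C v) -> C (barycenter x)) ->
  sd_supp barycenter x y -> fine C m d x -> fine C m (ratio m * d) y.
Proof.
move=> Cb; elim=> [[xm xC xd]|{}x z {}y zx zy IH xf]; first by split.
have [_ _ yd] := IH (fine_face xf zx); have [xm xC xd] := xf.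
have xy := sd_supp_cons zx zy.
have vx0 := face_ex zx.
(* [y] lies in the hull of [z], and a ball around the barycenter of [x] that contains the vertices
   of [z] contains this hull. *)
have bd w : w \in y -> `|w - barycenter x| <= ratio m * d.
  apply: (sd_supp_hull (C := fun w => `|w - barycenter x| <= ratio m * d) _ zy).
    by move=> x' x'0 x'M; exact: barycenter_dist.
  move=> v /(face_sub zx) vx; rewrite distrC; apply: barycenter_vertex_dist => // u ux.
  exact: xd.
split; first by rewrite (sd_supp_size xy).
  exact: sd_supp_hull xy xC.
move=> v w; rewrite !inE => /predU1P[->|vy] /predU1P[->|wy].
- have [u ux] := vx0; rewrite subrr normr0 mulr_ge0// ?divr_ge0 ?ler0n//.
  exact: le_trans (xd _ _ ux ux).
- by rewrite distrC bd.
- exact: bd.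
- exact: yd.
Qed.

Lemma iter_sd_rel (M M' : zmodType) (Rel : M -> M' -> Prop) (f : {linear V -> V})
    (C : V -> Prop) m :
  Rel 0 0 -> (forall a c a' c', Rel a a' -> Rel c c' -> Rel (a + c) (a' + c')) ->
  (forall x, x <> [::] -> (forall v, v \in x -> C v) -> C (barycenter x)) ->
  forall r d (G : seq V -> M) (G' : seq V -> M') x,
  (forall y, size y = size x -> fine C m (ratio m ^+ r * d) y -> Rel (G y) (G' (map f y))) ->
  fine C m d x ->
  Rel (iter r (sd barycenter) G x) (iter r (sd barycenter) G' (map f x)).
Proof.
move=> R0 RD Cb; elim=> [|r IH] d G G' x GG' xf; first by apply: GG' => //; rewrite expr0 mul1r.
apply: (sd_rel (Good := fine C m d) (f' := f)) => //.
- by move=> y z; exact: fine_face.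
- by move=> y _ _; rewrite -barycenter_linear /barycenter size_map.
move=> y xy; apply: (IH (ratio m * d)); last exact: sd_supp_fine xy xf.
by move=> z; rewrite mulrA -exprSr (sd_supp_size xy); exact: GG'.
Qed.

End Mesh.

Lemma ratio_exp_small (R : realType) m (d e : R) : 0 < e ->
  exists r, ratio R m ^+ r * d <= e.
Proof.
move=> e0; have m1 : `|ratio R m| < 1.
  rewrite ger0_norm ?divr_ge0// ltr_pdivrMr ?ltr0n// mul1r.
  by rewrite ltr_nat.
have /cvgr_dist_lt/(_ _ e0) := cvg_geometric d m1.
case=> r _ /(_ r (leqnn r)) /=; rewrite sub0r normrN => re; exists r.
by rewrite mulrC; apply: ltW; exact: le_lt_trans (ler_norm _) re.
Qed.

(** * From small simplices to a nerve *)

(** A nonempty set inside a member of the cover differs from its image, since that member is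
    disjoint from its own image. So a choice made on one set of each pair extends equivariantly. *)
Lemma equivariant_selection (X : tspace) (x0 : X) (A : tcover X) :
  exists F : set X -> A, forall S : set X, (S !=set0)%classic ->
    (exists U : A, (S `<=` fsval U)%classic) ->
    (S `<=` fsval (F S))%classic /\ F (tinv @` S)%classic = tact (F S).
Proof.
have [V0 V0A _] := tcover_cover A x0.
have /choice[f fE] : forall S : set X, exists V : A,
    (exists U : A, (S `<=` fsval U)%classic) -> (S `<=` fsval V)%classic.
  by move=> S; have [[U SU]|nU] := pselect (exists U : A, (S `<=` fsval U)%classic);
    [exists U|exists (FSetSub V0A)].
pose orb (S : set X) : set (set X) := fun S' => S' = S \/ S' = (tinv @` S)%classic.
(* [xget] sees only the unordered pair [orb S], so [S] and its image have the same
   representative. *)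
pose rep S := xget set0 (orb S).
have orbT S : orb (tinv @` S)%classic = orb S.
  by apply/seteqP; split=> S'; rewrite /orb tinv_imageK => -[]; auto.
have repP S : rep S = S \/ rep S = (tinv @` S)%classic.
  by apply: (@xgetPex _ set0 (orb S)); exists S; left.
have tf (S : set X) (U : A) : (S `<=` fsval U)%classic ->
    ((tinv @` S)%classic `<=` fsval (tact U))%classic.
  by move=> SU x [y Sy <-]; exists y => //; exact: SU.
exists (fun S => if `[< rep S = S >] then f S else tact (f (tinv @` S)%classic)).
move=> S [x Sx] [U SU].
have SneT : S <> (tinv @` S)%classic.
  move=> ST; apply: (tcover_disjoint (SU _ Sx)); apply: SU.
  by rewrite ST; exists x.
have TSsmall : exists U : A, ((tinv @` S)%classic `<=` fsval U)%classic.
  by exists (tact U); exact: tf.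
rewrite {2}/rep orbT -/(rep S) tinv_imageK.
have [/asboolP rS|/asboolP rS] := boolP `[< rep S = S >].
  split; first by apply: fE; exists U.
  by case: asboolP => //; rewrite rS.
split; first by rewrite -[X in (X `<=` _)%classic]tinv_imageK; apply: tf; exact: fE.
case: asboolP => [_|nr]; first by rewrite tactK.
by case: (repP S).
Qed.

Section NerveSubdivision.
Variables (X : tspace) (A : tcover X) (F : set X -> A).
Hypothesis FP : forall S : set X, (S !=set0)%classic ->
  (exists U : A, (S `<=` fsval U)%classic) ->
  (S `<=` fsval (F S))%classic /\ F (tinv @` S)%classic = tact (F S).
Variables (V : eqType) (g : V -> X).

Definition points (y : seq V) : set X := [set x | exists2 v, v \in y & g v = x]%classic.

Definition small (y : seq V) := exists U : A, forall v, v \in y -> fsval U (g v).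

Definition apex (y : seq V) : A := F (points y).

Lemma small_face y z : small y -> face z y -> small z.
Proof. by move=> [U yU] /face_sub zy; exists U => v /zy; exact: yU. Qed.

Lemma points_small y : small y -> exists U : A, (points y `<=` fsval U)%classic.
Proof. by move=> [U yU]; exists U => _ [v vy <-]; exact: yU. Qed.

Lemma points_nonempty y : y <> [::] -> (points y !=set0)%classic.
Proof. by case: y => // v y _; exists (g v); exists v; rewrite ?mem_head. Qed.

Lemma apex_in y v : small y -> v \in y -> fsval (apex y) (g v).
Proof.
move=> sy vy; have y0 : y <> [::] by case: (y) vy.
by have [+ _] := FP (points_nonempty y0) (points_small sy); apply; exists v.
Qed.

Definition nerve_sd := sd apex (@sym A).

(** Every member attached to a flag contains the vertex of the smallest nonempty face of the flag,
    so the members form a simplex of the nerve. *)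
Lemma sd_supp_nerve y w : sd_supp apex y w -> small y -> y <> [::] ->
  exists2 v, v \in y & forall U, U \in w -> fsval U (g v).
Proof.
elim=> // {}y z {}w zy zw IH sy y0; have sz := small_face sy zy.
have [z0|/eqP zn0] := eqVneq z [::]; last first.
  have [v vz vw] := IH sz zn0; have vy := face_sub zy vz.
  by exists v => // U; rewrite inE => /predU1P[->|/vw//]; exact: apex_in.
have [v vy] := face_ex zy; exists v => // U.
have w0 : w = [::] by apply/nilP; rewrite /nilp (sd_supp_size zw) z0.
by rewrite w0 inE => /eqP ->; exact: apex_in.
Qed.

Lemma nerve_sd_chains y k : small y -> size y = k.+1 -> nerve_sd y \in chains (nerve A) k.
Proof.
move=> sy yk; have y0 : y <> [::] by case: (y) yk.
have := sd_rel (b := apex) (b' := apex) (f := id) (f' := id)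
  (Rel := fun a _ : chain A => a \in chains (nerve A) k) (Good := fun=> True)
  _ _ _ _ (G := @sym A) (G' := @sym A) (x := y).
apply=> //; first exact: chains0.
- by move=> a c _ _; exact: chainsD.
- by move=> x _ _; rewrite map_id.
move=> w yw; apply: sym_chains; first by rewrite (sd_supp_size yw).
have [v vy vw] := sd_supp_nerve yw sy y0; apply/nerveP; split.
  have : (0 < size w)%N by rewrite (sd_supp_size yw) yk.
  by case: (w) => // U w' _; apply/set0Pn; exists U; rewrite inE mem_head.
by exists (g v) => U; rewrite inE; exact: vw.
Qed.

Lemma nerve_sd_equivariant (T : V -> V) y : small y ->
  (forall v, v \in y -> g (T v) = tinv (g v)) ->
  pushforward (@tact X A) (nerve_sd y) = nerve_sd (map T y).
Proof.
move=> sy gT.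
apply: (sd_rel (b := apex) (b' := apex) (f := T) (f' := @tact X A)
  (Rel := fun a a' : chain A => pushforward (@tact X A) a = a')
  (Good := fun z => small z /\ forall v, v \in z -> g (T v) = tinv (g v))) => //.
- by rewrite raddf0.
- by move=> a c a' c' <- <-; rewrite raddfD.
- move=> x z [sx xT] zx; split; first exact: small_face zx.
  by move=> v /(face_sub zx); exact: xT.
- move=> x [sx xT] x0.
  have [_ <-] := FP (points_nonempty x0) (points_small sx); congr F.
  apply/seteqP; split=> [_ [_ /mapP[v vx ->] <-]|_ [_ [v vx <-] <-]].
    by exists (g v); [exists v|rewrite xT].
  by exists (T v); [exact: map_f|exact: xT].
- by move=> w _; rewrite pushforward_sym.
Qed.

Lemma nerve_sd_invariant (f : V -> V) y :
  (forall v, v \in y -> g (f v) = g v) -> nerve_sd y = nerve_sd (map f y).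
Proof.
move=> gf.
apply: (sd_rel (b := apex) (b' := apex) (f := f) (f' := id)
  (Rel := eq) (Good := fun z => forall v, v \in z -> g (f v) = g v)) => //.
- by move=> a c a' c' -> ->.
- by move=> x z xT zx v /(face_sub zx); exact: xT.
- move=> x xT x0; congr F.
  apply/seteqP; split=> [_ [_ /mapP[v vx ->] <-]|_ [v vx <-]].
    by exists v => //; rewrite xT.
  by exists (f v); [exact: map_f|exact: xT].
- by move=> w _; rewrite map_id.
Qed.

Lemma boundary_nerve_sd y : boundary (nerve_sd y) = dl nerve_sd y.
Proof.
rewrite /nerve_sd sd_add/= dl_sd; last exact: addcc.
by rewrite (_ : (fun y => boundary (sym y)) = dl (@sym A))//; apply/funext => w; exact: boundary_sym.
Qed.

Lemma sum_nerve_sd1 v : \sum_s nerve_sd [:: v] s = 1.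
Proof. by rewrite /nerve_sd sd1 sum_sym1. Qed.

End NerveSubdivision.

Section NerveMap.
Variables (R : realType) (V : normedModType R) (X : tspace) (A : tcover X) (F : set X -> A).
Hypothesis FP : forall S : set X, (S !=set0)%classic ->
  (exists U : A, (S `<=` fsval U)%classic) ->
  (S `<=` fsval (F S))%classic /\ F (tinv @` S)%classic = tact (F S).
Variables (g : V -> X) (C : V -> Prop) (m r : nat) (d : R).
Hypothesis Cb : forall x, x <> [::] -> (forall v, v \in x -> C v) -> C (barycenter x).
Hypothesis Csmall : forall y, fine C m (ratio R m ^+ r * d) y -> small A g y.

(** By the reversed order of functionals, a simplex is first subdivided [r] times; [nerve_sd] then
    subdivides each piece once more and sends the flags to the nerve. *)
Definition nerve_chain : seq V -> chain A :=
  iter r (sd (@barycenter R V)) (nerve_sd F g).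

Lemma nerve_chain_add (h : {additive chain A -> chain A}) (G : seq V -> chain A) k x :
  h (iter k (sd (@barycenter R V)) G x) =
  iter k (sd (@barycenter R V)) (fun y => h (G y)) x.
Proof.
by elim: k x => //= k IH x; rewrite sd_add; congr sd; apply/funext.
Qed.

Lemma boundary_nerve_chain x : boundary (nerve_chain x) = dl nerve_chain x.
Proof.
rewrite /nerve_chain nerve_chain_add/=.
rewrite (_ : (fun y => boundary (nerve_sd F g y)) = dl (nerve_sd F g)); last first.
  by apply/funext => y; exact: boundary_nerve_sd.
elim: r x => //= k IH x; rewrite dl_sd; last exact: addcc.
by congr sd; apply/funext.
Qed.

Lemma nerve_chain_chains k x : fine C m d x -> size x = k.+1 ->
  nerve_chain x \in chains (nerve A) k.
Proof.
move=> xf xk.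
have := @iter_sd_rel R V _ _ (fun a _ : chain A => a \in chains (nerve A) k) idfun C m.
move=> /(_ (chains0 _ _) (fun a c _ _ => @chainsD _ _ _ a c) Cb r d
  (nerve_sd F g) (nerve_sd F g) x).
apply=> // y yx yf.
by apply: nerve_sd_chains => //; [exact: Csmall|rewrite yx].
Qed.

Lemma nerve_chain_equivariant (T : {linear V -> V}) x : fine C m d x ->
  (forall v, C v -> g (T v) = tinv (g v)) ->
  pushforward (@tact X A) (nerve_chain x) = nerve_chain (map T x).
Proof.
move=> xf gT.
apply: (iter_sd_rel (Rel := fun a a' : chain A => pushforward (@tact X A) a = a')
  _ _ Cb _ xf).
- by rewrite raddf0.
- by move=> a c a' c' <- <-; rewrite raddfD.
move=> y _ yf; apply: nerve_sd_equivariant => //; first exact: Csmall.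
by move=> v vy; apply: gT; case: yf => _ + _; apply.
Qed.

Lemma nerve_chain_invariant (f : {linear V -> V}) x : fine C m d x ->
  (forall v, C v -> g (f v) = g v) -> nerve_chain x = nerve_chain (map f x).
Proof.
move=> xf gf; apply: (iter_sd_rel (Rel := eq) _ _ Cb _ xf) => //.
  by move=> a c a' c' -> ->.
move=> y _ yf; apply: nerve_sd_invariant.
by move=> v vy; apply: gf; case: yf => _ + _; apply.
Qed.

Lemma sum_nerve_chain1 v : \sum_s nerve_chain [:: v] s = 1.
Proof.
rewrite /nerve_chain; elim: r v => [|k IH] v /=; first exact: sum_nerve_sd1.
by rewrite sd1.
Qed.

End NerveMap.

(** * The index of the twisted prism *)

Section Sphere.
Variables (V M : zmodType) (e : nat -> V).

(* The boundary of the cross-polytope with vertices e i and - e i for i < k. *)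
Fixpoint sphere (k : nat) (G : seq V -> M) : M :=
  if k is k'.+1 then
    sphere k' (fun y => G (e k' :: y)) + sphere k' (fun y => G (- e k' :: y))
  else G [::].

Fixpoint orthant (sigma : nat -> bool) (k : nat) : seq V :=
  if k is k'.+1 then (if sigma k' then e k' else - e k') :: orthant sigma k' else [::].

Lemma eq_orthant sigma tau k : (forall i, (i < k)%N -> sigma i = tau i) ->
  orthant sigma k = orthant tau k.
Proof.
elim: k => //= k IH st; rewrite st// IH// => i ik; apply: st; exact: ltnW.
Qed.

Lemma size_orthant sigma k : size (orthant sigma k) = k.
Proof. by elim: k => //= k ->. Qed.

Lemma sphereD k (G G' : seq V -> M) :
  sphere k (fun y => G y + G' y) = sphere k G + sphere k G'.
Proof. by elim: k G G' => //= k IH G G'; rewrite !IH addrACA. Qed.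

(** Each face is shared by the two simplices that differ in the sign of the dropped vertex. *)
Lemma sphere_dl k (G : seq V -> M) : (forall a : M, a + a = 0) -> sphere k (dl G) = 0.
Proof.
move=> M2; elim: k G => //= k IH G; rewrite !sphereD !IH !addr0; exact: M2.
Qed.

Lemma sphere_neg k (G : seq V -> M) : sphere k (fun y => G (map -%R y)) = sphere k G.
Proof.
elim: k G => //= k IH G; rewrite (IH (fun y => G (- e k :: y))).
by rewrite opprK (IH (fun y => G (e k :: y))) addrC.
Qed.

End Sphere.

Lemma sphere_rel (V M M' : zmodType) (e : nat -> V) (Rel : M -> M' -> Prop) k
    (G : seq V -> M) (G' : seq V -> M') :
  (forall a c a' c', Rel a a' -> Rel c c' -> Rel (a + c) (a' + c')) ->
  (forall sigma, Rel (G (orthant e sigma k)) (G' (orthant e sigma k))) ->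
  Rel (sphere e k G) (sphere e k G').
Proof.
move=> RD; elim: k G G' => [|k IH] G G' GG' /=; first exact: (GG' xpredT).
have ext (b : bool) sigma : exists2 tau : nat -> bool, tau k = b &
    orthant e sigma k = orthant e tau k.
  exists (fun i => if i == k then b else sigma i); first by rewrite eqxx.
  by apply: eq_orthant => i ik; rewrite ltn_eqF.
apply: RD; apply: IH => sigma.
  by have [tau tk ->] := ext true sigma; have := GG' tau; rewrite /= tk.
by have [tau tk ->] := ext false sigma; have := GG' tau; rewrite /= tk.
Qed.

Lemma eq_sphere (V M : zmodType) (e : nat -> V) k (G G' : seq V -> M) :
  (forall sigma, G (orthant e sigma k) = G' (orthant e sigma k)) ->
  sphere e k G = sphere e k G'.
Proof. by apply: (sphere_rel (Rel := eq)) => a c a' c' -> ->. Qed.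

Lemma sphere_add (V M M' : zmodType) (e : nat -> V) k (h : {additive M -> M'})
    (G : seq V -> M) :
  h (sphere e k G) = sphere e k (fun y => h (G y)).
Proof. by elim: k G => //= k IH G; rewrite raddfD !IH. Qed.

Section TwistedPrism.
Variables (W : finType) (K : {set {set W}}) (t : W -> W).
Hypothesis Kt : free_complex K t.
Variables (V : zmodType) (e : nat -> V) (L : nat) (rho : V -> V).
(** Chains carried by the bottom, the top and the whole prism over a simplex of the cross-polytope:
    over [k] vertices the prism has dimension [k] and its ends [k - 1]. The gluing is [Etop_bot],
    where [rho] is the twist seen on the base. *)
Variables Ebot Etop Epr : seq V -> chain W.

Hypothesis Ebot_chains : forall sigma k, (k <= L)%N ->
  Ebot (orthant e sigma k.+1) \in chains K k.
Hypothesis Epr_chains : forall sigma k, (k <= L.+1)%N ->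
  Epr (orthant e sigma k) \in chains K k.
Hypothesis Epr0 : Epr [::] = 0.
Hypothesis Ebot_inv : forall sigma k, (k <= L.+1)%N ->
  pushforward t (Ebot (orthant e sigma k)) = Ebot (map -%R (orthant e sigma k)).
Hypothesis Epr_inv : forall sigma k, (k <= L.+1)%N ->
  pushforward t (Epr (orthant e sigma k)) = Epr (map -%R (orthant e sigma k)).
Hypothesis Ebot_boundary : forall x, boundary (Ebot x) = dl Ebot x.
Hypothesis Epr_boundary : forall x, boundary (Epr x) = Etop x + Ebot x + dl Epr x.
Hypothesis Etop_bot : forall sigma k, (k <= L.+1)%N ->
  Etop (orthant e sigma k) = Ebot (map rho (orthant e sigma k)).
Hypothesis rho_last : forall b : bool, rho (if b then e L else - e L) = if b then e L else - e L.
Hypothesis rho_neg : forall (b : bool) i, (i < L)%N ->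
  rho (if b then e i else - e i) = - (if b then e i else - e i).
Hypothesis Ebot1 : forall v, \sum_s Ebot [:: v] s = 1.

Let hemi (G : seq V -> chain W) k := sphere e k (fun y => G (e k :: y)).

Lemma orthant_rho sigma k : (k <= L)%N ->
  map rho (orthant e sigma k) = map -%R (orthant e sigma k).
Proof.
elim: k => //= k IH kL; rewrite IH; last exact: ltnW.
by rewrite rho_neg.
Qed.

Let orthant_cons b sigma k : exists2 tau,
  (if b then e k else - e k) :: orthant e sigma k = orthant e tau k.+1 & tau k = b.
Proof.
exists (fun i => if i == k then b else sigma i); last by rewrite eqxx.
rewrite /= eqxx; congr (_ :: _); apply: eq_orthant => i ik.
by rewrite ltn_eqF.
Qed.

(** The antipode carries the half with [e k] to the half with [- e k], because the sphere in the
    lower coordinates is symmetric. *)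
Lemma sphere_half (G : seq V -> chain W) k :
  (forall sigma, pushforward t (G (orthant e sigma k.+1)) =
                 G (map -%R (orthant e sigma k.+1))) ->
  sphere e k.+1 G = hemi G k + pushforward t (hemi G k).
Proof.
move=> Gt; rewrite /= /hemi sphere_add/=; congr (_ + _).
rewrite -sphere_neg; apply: eq_sphere => sigma.
have [tau tauE _] := orthant_cons true sigma k.
by rewrite [e k :: _]tauE Gt -tauE.
Qed.

Lemma hemi_chains (G : seq V -> chain W) k j :
  (forall sigma, G (orthant e sigma k.+1) \in chains K j) -> hemi G k \in chains K j.
Proof.
move=> GK; apply: (sphere_rel (Rel := fun a _ : chain W => a \in chains K j)
  (G' := fun=> 0)).
  by move=> a c _ _; exact: chainsD.
by move=> sigma; have [tau tauE _] := orthant_cons true sigma k; rewrite [e k :: _]tauE.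
Qed.

Lemma boundary_sphere k (G : seq V -> chain W) :
  boundary (sphere e k G) = sphere e k (fun y => boundary (G y)).
Proof. exact: sphere_add. Qed.

Lemma boundary_hemi_bot k : boundary (hemi Ebot k) = sphere e k Ebot.
Proof.
rewrite /hemi boundary_sphere.
rewrite (eq_sphere (G' := fun y => Ebot y + dl (fun z => Ebot (e k :: z)) y)).
  by rewrite sphereD (sphere_dl _ _ _ (@addcc W)) addr0.
by move=> sigma; rewrite Ebot_boundary.
Qed.

Lemma boundary_hemi_pr k : boundary (hemi Epr k) =
  hemi Etop k + hemi Ebot k + sphere e k Epr.
Proof.
rewrite /hemi boundary_sphere.
rewrite (eq_sphere (G' := fun y => Etop (e k :: y) + Ebot (e k :: y) +
   (Epr y + dl (fun z => Epr (e k :: z)) y))).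
  by rewrite !sphereD (sphere_dl _ _ _ (@addcc W)) addr0.
by move=> sigma; rewrite Epr_boundary.
Qed.

Lemma sphere_bot_cycle k : (k <= L)%N -> sphere e k.+1 Ebot \in inv_cycles K t k.
Proof.
move=> kL; rewrite inE (@sphere_half Ebot k) => [|sigma]; last exact: Ebot_inv.
rewrite half_inv_chains//=; last by apply: hemi_chains => sigma; exact: Ebot_chains.
rewrite -(@sphere_half Ebot k) => [|sigma]; last exact: Ebot_inv.
rewrite boundary_sphere (eq_sphere (G' := dl Ebot)) => [|sigma]; last exact: Ebot_boundary.
by rewrite (sphere_dl _ _ _ (@addcc W)).
Qed.

Lemma nu_sphere_bot k : (k <= L)%N -> nu K t k (sphere e k.+1 Ebot) = 1.
Proof.
have half k' : (k' <= L)%N -> nu K t k' (sphere e k'.+1 Ebot) = half_nu K t k' (hemi Ebot k').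
  move=> kL; have [_ c0] := inv_cyclesP (sphere_bot_cycle kL); move: c0.
  rewrite (@sphere_half Ebot k') => [c0|sigma]; last exact: Ebot_inv.
  by apply: nu_half => //; apply: hemi_chains => sigma; exact: Ebot_chains.
elim: k => [|k IH] kL; rewrite half//=; first exact: Ebot1.
by rewrite boundary_hemi_bot IH// ltnW.
Qed.

(** On the coordinates below [k], [rho] is the antipode, which preserves their sphere; only the
    leading vertex still shows the effect of the gluing. *)
Lemma sphere_top_cons b k : (k <= L)%N ->
  sphere e k (fun y => Etop ((if b then e k else - e k) :: y)) =
  sphere e k (fun y => Ebot (rho (if b then e k else - e k) :: y)).
Proof.
move=> kL; rewrite -[RHS]sphere_neg; apply: eq_sphere => sigma.
have [tau tauE _] := orthant_cons b sigma k.
by rewrite tauE Etop_bot// -tauE/= orthant_rho.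
Qed.

Lemma hemi_top_last : hemi Etop L = hemi Ebot L.
Proof. by rewrite /hemi (@sphere_top_cons true L)// (rho_last true). Qed.

Lemma hemi_top k : (k < L)%N -> hemi Etop k + hemi Ebot k = sphere e k.+1 Ebot.
Proof.
move=> kL; rewrite /= /hemi (@sphere_top_cons true k); last exact: ltnW.
by rewrite (rho_neg true)// addrC.
Qed.

Lemma sphere_top k : (k <= L)%N -> sphere e k.+1 Etop = sphere e k.+1 Ebot.
Proof.
move=> kL /=; rewrite (@sphere_top_cons true k kL) (@sphere_top_cons false k kL).
move: kL; rewrite leq_eqVlt => /predU1P[->|kL].
  by rewrite (rho_last true) (rho_last false).
by rewrite (rho_neg true)// (rho_neg false)// opprK addrC.
Qed.

Lemma sphere_pr_cycle k : (k <= L.+1)%N -> sphere e k Epr \in inv_cycles K t k.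
Proof.
case: k => [_|k kL]; first by rewrite /= Epr0 inv_cycles0.
rewrite inE (@sphere_half Epr k) => [|sigma]; last exact: Epr_inv.
rewrite half_inv_chains//=; last by apply: hemi_chains => sigma; exact: Epr_chains.
rewrite -(@sphere_half Epr k) => [|sigma]; last exact: Epr_inv.
rewrite boundary_sphere (eq_sphere (G' := fun x => Etop x + Ebot x + dl Epr x)) => [|sigma];
  last exact: Epr_boundary.
rewrite !sphereD (sphere_dl _ _ _ (@addcc W)) addr0.
by rewrite (sphere_top kL) addcc.
Qed.

Let nu_pr_half k : (k <= L)%N ->
  nu K t k.+1 (sphere e k.+1 Epr) = nu K t k (boundary (hemi Epr k)).
Proof.
move=> kL; have [_ c0] := inv_cyclesP (@sphere_pr_cycle k.+1 kL); move: c0.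
rewrite (@sphere_half Epr k) => [c0|sigma]; last exact: Epr_inv.
by rewrite nu_half//; apply: hemi_chains => sigma; exact: Epr_chains.
Qed.

(** [sphere e k Epr] is the prism over the sphere of dimension [k - 1], empty for [k = 0]. Each
    negated coordinate adds 1, the index of one end. *)
Lemma nu_sphere_pr k : (k <= L)%N -> nu K t k (sphere e k Epr) = k%:R.
Proof.
elim: k => [|k IH] kL; first by rewrite /= Epr0 -[LHS]/(nu K t 0 0) nu0.
rewrite nu_pr_half; last exact: ltnW.
rewrite boundary_hemi_pr hemi_top// nuD ?sphere_bot_cycle ?sphere_pr_cycle//;
  try by rewrite ltnW// ltnW.
by rewrite nu_sphere_bot ?IH ?(ltnW kL)// -natr1 addrC.
Qed.

Lemma nu_sphere_pr_top : odd L -> nu K t L.+1 (sphere e L.+1 Epr) = 1.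
Proof.
move=> oL; rewrite nu_pr_half// boundary_hemi_pr hemi_top_last addcc add0r.
by rewrite nu_sphere_pr// -[L]odd_double_half oL natrD -muln2 natrM mulr_natr [_ *+ 2]addF2 addr0.
Qed.

End TwistedPrism.

(** * The prism in coordinates *)

Section Parametrization.
Variables (R : realType) (L : nat).
Notation V := 'rV[R]_L.+2.
Implicit Types (z v : V) (sigma : nat -> bool).

(** The prism lies in a space of [L + 2] coordinates: entry 0 is the height, in [[-1, 1]], and the
    others run over the unit sphere of the l1 norm, the boundary of the cross-polytope. *)
Definition height z : R := z ord0 ord0.
Definition coef z (i : nat) : R := z ord0 (inord i.+1).

Definition antipode : 'M[R]_L.+2 := diag_mx (\row_j (-1) ^+ (j != ord0)).
(** The twist exchanges the ends, so it negates the height as well. [ord_max] is the entry of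
    coefficient [L], the direction that stays inside the fixed 2-plane. *)
Definition twist : 'M[R]_L.+2 := diag_mx (\row_j (-1) ^+ (j != ord_max)).

Lemma inordS_neq0 i : (i < L.+1)%N -> (inord i.+1 : 'I_L.+2) != ord0.
Proof. by move=> iL; rewrite -val_eqE /= inordK. Qed.

Lemma inordS_max i : (i < L.+1)%N -> ((inord i.+1 : 'I_L.+2) == ord_max) = (i == L).
Proof. by move=> iL; rewrite -val_eqE /= inordK. Qed.

Lemma height_antipode z : height (mulmxr antipode z) = height z.
Proof. by rewrite /height /= mul_mx_diag !mxE eqxx mulr1. Qed.

Lemma coef_antipode z i : (i < L.+1)%N -> coef (mulmxr antipode z) i = - coef z i.
Proof.
by move=> iL; rewrite /coef /= mul_mx_diag !mxE inordS_neq0// expr1 mulrN1.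
Qed.

Lemma height_twist z : height (mulmxr twist z) = - height z.
Proof. by rewrite /height /= mul_mx_diag !mxE -val_eqE /= expr1 mulrN1. Qed.

Lemma coef_twist z i : (i < L.+1)%N ->
  coef (mulmxr twist z) i = if i == L then coef z i else - coef z i.
Proof.
move=> iL; rewrite /coef /= mul_mx_diag !mxE inordS_max//.
by case: eqP => _; rewrite ?mulr1// expr1 mulrN1.
Qed.

Lemma param_eq z v : height z = height v ->
  (forall i, (i < L.+1)%N -> coef z i = coef v i) -> z = v.
Proof.
move=> hzv czv; apply/rowP => j; have [->//|j0] := eqVneq j ord0.
have jL : (j.-1 < L.+1)%N by case: j j0 => [[|j] //= jL] _.
have := czv _ jL; rewrite /coef prednK ?inord_val// lt0n.
by rewrite -val_eqE in j0.
Qed.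

Definition sgn (b : bool) : R := (-1) ^+ (~~ b).

(** A convex piece of [prism_domain]. The whole domain is not convex, but the part with prescribed
    signs is, so subdividing a simplex of the prism never leaves the domain. *)
Definition cell sigma z := [/\ `|height z| <= 1,
  forall i, (i < L.+1)%N -> 0 <= sgn (sigma i) * coef z i &
  \sum_(i < L.+1) sgn (sigma i) * coef z i = 1].

Definition prism_domain z := `|height z| <= 1 /\ \sum_(i < L.+1) `|coef z i| = 1.

Lemma normr_sgn b x : `|sgn b * x| = `|x|.
Proof. by rewrite normrM /sgn normrX normrN1 expr1n mul1r. Qed.

Lemma cell_domain sigma z : cell sigma z -> prism_domain z.
Proof.
move=> [hz cz c1]; split=> //; rewrite -c1; apply: eq_bigr => i _.
by rewrite -(normr_sgn (sigma i)) ger0_norm// cz.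
Qed.

Lemma domain_antipode z : prism_domain z -> prism_domain (mulmxr antipode z).
Proof.
move=> [hz cz]; split; first by rewrite height_antipode.
by rewrite -cz; apply: eq_bigr => i _; rewrite coef_antipode// normrN.
Qed.

Lemma domain_twist z : prism_domain z -> prism_domain (mulmxr twist z).
Proof.
move=> [hz cz]; split; first by rewrite height_twist normrN.
by rewrite -cz; apply: eq_bigr => i _; rewrite coef_twist//; case: eqP; rewrite ?normrN.
Qed.

Lemma domain_norm z : prism_domain z -> `|z| <= 1.
Proof.
move=> [hz cz]; have [z0|/mx_norm_neq0[[i j] zE]] := eqVneq (mx_norm z) 0.
  by rewrite [ `|z| ]z0.
rewrite [ `|z| ]zE /= ord1; have [->//|j0] := eqVneq j ord0.
have jL : (j.-1 < L.+1)%N by case: j j0 {zE} => [[|j] //= jL] _.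
have -> : z ord0 j = coef z j.-1.
  by rewrite /coef prednK ?inord_val// lt0n; rewrite -val_eqE in j0.
rewrite -cz (bigD1 (Ordinal jL))//= lerDl sumr_ge0//.
Qed.

Lemma average_le (x : seq V) (h : V -> R) c : x <> [::] ->
  (forall v, v \in x -> h v <= c) -> (size x)%:R^-1 * \sum_(v <- x) h v <= c.
Proof.
move=> x0 hc; have sx : 0 < (size x)%:R :> R by case: x x0 {hc}.
rewrite mulrC ler_pdivrMr// mulr_natr -[X in c *+ X]count_predT -iter_addr_0 -big_const_seq.
by rewrite big_seq [leRHS]big_seq; apply: ler_sum.
Qed.

Lemma average_ge (x : seq V) (h : V -> R) c : x <> [::] ->
  (forall v, v \in x -> c <= h v) -> c <= (size x)%:R^-1 * \sum_(v <- x) h v.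
Proof.
move=> x0 hc; rewrite -lerN2 -mulrN -sumrN; apply: average_le => // v vx.
by rewrite lerN2 hc.
Qed.

Lemma barycenter_entry (x : seq V) j :
  barycenter x ord0 j = (size x)%:R^-1 * \sum_(v <- x) v ord0 j.
Proof. by rewrite /barycenter mxE summxE. Qed.

Lemma cell_barycenter sigma (x : seq V) : x <> [::] ->
  (forall v, v \in x -> cell sigma v) -> cell sigma (barycenter x).
Proof.
move=> x0 xC; split.
- rewrite /height barycenter_entry ler_norml; apply/andP; split.
    by apply: average_ge => // v /xC[+ _ _]; rewrite ler_norml => /andP[].
  by apply: average_le => // v /xC[+ _ _]; rewrite ler_norml => /andP[].
- move=> i iL; rewrite /coef barycenter_entry mulrCA mulr_sumr.
  by apply: average_ge => // v /xC[_ + _]; exact.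
under eq_bigr do rewrite /coef barycenter_entry mulrCA mulr_sumr.
rewrite -mulr_sumr exchange_big/=; apply/eqP; rewrite eq_le; apply/andP; split.
  by apply: average_le => // v /xC[_ _ ->].
by apply: average_ge => // v /xC[_ _ ->].
Qed.

Definition axis (i : nat) : V := \row_j (j == i.+1 :> nat)%:R.
Definition pole : V := \row_j (j == 0 :> nat)%:R.

Lemma height_axis i : height (axis i) = 0.
Proof. by rewrite /height mxE. Qed.

Lemma coef_axis i k : (k < L.+1)%N -> coef (axis i) k = (k == i)%:R.
Proof. by move=> kL; rewrite /coef mxE inordK. Qed.

Lemma height_pole : height pole = 1.
Proof. by rewrite /height mxE. Qed.

Lemma coef_pole k : (k < L.+1)%N -> coef pole k = 0.
Proof. by move=> kL; rewrite /coef mxE inordK. Qed.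

Lemma heightD z v : height (z + v) = height z + height v. Proof. by rewrite /height mxE. Qed.
Lemma heightN z : height (- z) = - height z. Proof. by rewrite /height mxE. Qed.
Lemma coefD z v i : coef (z + v) i = coef z i + coef v i. Proof. by rewrite /coef mxE. Qed.
Lemma coefN z i : coef (- z) i = - coef z i. Proof. by rewrite /coef mxE. Qed.

Definition bottom z := z - pole.
Definition top z := z + pole.

Notation vertex b i := (if b then axis i else - axis i).

Lemma height_vertex b i : height (vertex b i) = 0.
Proof. by case: b; rewrite ?heightN height_axis ?oppr0. Qed.

Lemma coef_vertex b i k : (k < L.+1)%N -> coef (vertex b i) k = sgn b * (k == i)%:R.
Proof.
by move=> kL; case: b; rewrite ?coefN coef_axis// /sgn ?mul1r// expr1 mulN1r.
Qed.

Lemma cell_vertex sigma i z : (i < L.+1)%N -> `|height z| <= 1 ->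
  (forall k, (k < L.+1)%N -> coef z k = coef (vertex (sigma i) i) k) -> cell sigma z.
Proof.
move=> iL hz cz.
have zE k : (k < L.+1)%N -> sgn (sigma k) * coef z k = (k == i)%:R.
  move=> kL; rewrite cz// coef_vertex//; have [->|_] := eqVneq k i; last by rewrite !mulr0.
  by rewrite mulr1 /sgn -expr2 sqrr_sign.
split=> // [k kL|]; first by rewrite zE// ler0n.
rewrite (bigD1 (Ordinal iL))//= zE// eqxx big1 ?addr0// => k ki.
by rewrite zE//; case: eqP => // kE; move: ki; rewrite -val_eqE /= kE eqxx.
Qed.

Lemma cell_bottom sigma i : (i < L.+1)%N -> cell sigma (bottom (vertex (sigma i) i)).
Proof.
move=> iL; apply: (cell_vertex iL).
  by rewrite heightD heightN height_pole height_vertex add0r normrN1.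
by move=> k kL; rewrite coefD coefN coef_pole// subr0.
Qed.

Lemma cell_top sigma i : (i < L.+1)%N -> cell sigma (top (vertex (sigma i) i)).
Proof.
move=> iL; apply: (cell_vertex iL).
  by rewrite heightD height_pole height_vertex add0r normr1.
by move=> k kL; rewrite coefD coef_pole// addr0.
Qed.

Lemma antipode_vertex b i : mulmxr antipode (vertex b i) = - vertex b i.
Proof.
apply: param_eq => [|k kL]; first by rewrite height_antipode heightN height_vertex oppr0.
by rewrite coef_antipode// coefN.
Qed.

Lemma antipode_pole : mulmxr antipode pole = pole.
Proof.
apply: param_eq => [|k kL]; first by rewrite height_antipode.
by rewrite coef_antipode// coef_pole// oppr0.
Qed.

Lemma twist_pole : mulmxr twist pole = - pole.
Proof.
apply: param_eq => [|k kL]; first by rewrite height_twist heightN.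
by rewrite coef_twist// coefN coef_pole// oppr0 if_same.
Qed.

Lemma twist_last b : mulmxr twist (vertex b L) = vertex b L.
Proof.
apply: param_eq => [|k kL]; first by rewrite height_twist height_vertex oppr0.
rewrite coef_twist// coef_vertex//.
by case: (k =P L) => // _; rewrite mulr0 oppr0.
Qed.

Lemma twist_vertex b i : (i < L)%N -> mulmxr twist (vertex b i) = - vertex b i.
Proof.
move=> iL; apply: param_eq => [|k kL]; first by rewrite height_twist heightN.
rewrite coef_twist// coefN coef_vertex//; case: (k =P L) => // ->.
by rewrite gtn_eqF// mulr0 oppr0.
Qed.

Lemma antipode_bottom b i :
  mulmxr antipode (bottom (vertex b i)) = bottom (- vertex b i).
Proof. by rewrite /bottom -antipode_vertex -[in RHS]antipode_pole; exact: linearB. Qed.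

Lemma antipode_top b i : mulmxr antipode (top (vertex b i)) = top (- vertex b i).
Proof. by rewrite /top -antipode_vertex -[in RHS]antipode_pole; exact: linearD. Qed.

Lemma twist_top z : mulmxr twist (top z) = bottom (mulmxr twist z).
Proof. by rewrite /top /bottom -twist_pole; exact: linearD. Qed.

End Parametrization.

(** * Oriented planes from points of the prism *)

Section Frame.
Variables (R : realType) (L : nat).
Notation V := 'rV[R]_L.+2.
Implicit Types (z v : V).

(* The rational parametrization of a half circle, from (0, -1) to (0, 1). *)
Definition circ1 (s : R) : R := (1 - s ^+ 2) / (1 + s ^+ 2).
Definition circ2 (s : R) : R := (s *+ 2) / (1 + s ^+ 2).

Lemma circ_den (s : R) : 1 + s ^+ 2 != 0.
Proof. by rewrite gt_eqF// ltr_pwDl// sqr_ge0. Qed.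

Lemma circ_sqr s : circ1 s ^+ 2 + circ2 s ^+ 2 = 1.
Proof. by rewrite /circ1 /circ2; field; exact: circ_den. Qed.

Definition len z : R := Num.sqrt (\sum_(i < L.+1) coef z i ^+ 2).

Definition fst_entry z (i : nat) : R :=
  match i with 0 => circ1 (height z) | 1 => circ2 (height z) | _ => 0 end.

(** Coefficient [L] multiplies the first vector turned by a right angle in the plane of the first
    two basis vectors; the other coefficients lie along the remaining basis vectors. *)
Definition snd_entry z (i : nat) : R :=
  match i with
  | 0 => - circ2 (height z) * coef z L
  | 1 => circ1 (height z) * coef z L
  | k.+2 => coef z k
  end.

(* The oriented plane through the point v of the half circle of height z and the
   rotation by the argument of v of the unit vector along the coefficients of z,
   seen in the orthogonal complement of the first basis vector. *)
Definition frame z : 'M[R]_(L.+2, 2) :=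
  \matrix_(i, j) if j == ord0 then fst_entry z i else snd_entry z i / len z.

Lemma domain_len z : prism_domain z -> len z != 0.
Proof.
move=> [_ cz]; rewrite gt_eqF// sqrtr_gt0 lt0r sumr_ge0 ?andbT => [|i _]; last exact: sqr_ge0.
apply: contra_eq_neq cz => /eqP; rewrite psumr_eq0 => [/allP c0|i _]; last exact: sqr_ge0.
rewrite big1 ?(eq_sym 0) ?oner_eq0// => i _; have := c0 i; rewrite mem_index_enum => /(_ isT).
by rewrite sqrf_eq0 => /eqP ->; rewrite normr0.
Qed.

Lemma len_sqr z : len z ^+ 2 = \sum_(i < L.+1) coef z i ^+ 2.
Proof. by rewrite sqr_sqrtr// sumr_ge0// => i _; exact: sqr_ge0. Qed.

Lemma len_antipode z : len (mulmxr (antipode R L) z) = len z.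
Proof. by congr Num.sqrt; apply: eq_bigr => i _; rewrite coef_antipode// sqrrN. Qed.

Lemma len_twist z : len (mulmxr (twist R L) z) = len z.
Proof.
by congr Num.sqrt; apply: eq_bigr => i _; rewrite coef_twist//; case: eqP; rewrite ?sqrrN.
Qed.

Lemma sum_rows (h : nat -> R) :
  \sum_(i < L.+2) h i = h 0%N + h 1%N + \sum_(k < L) h k.+2.
Proof. by rewrite !big_ord_recl addrA. Qed.

Lemma frame_stiefel z : prism_domain z -> stiefel R L.+2 2 (frame z).
Proof.
move=> Dz; have l0 := domain_len Dz.
have fst_fst : \sum_(i < L.+2) fst_entry z i * fst_entry z i = 1.
  rewrite (sum_rows (fun i => fst_entry z i * fst_entry z i))/= big1 => [|k _].
    by rewrite addr0 -!expr2 circ_sqr.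
  by rewrite mulr0.
have fst_snd : \sum_(i < L.+2) fst_entry z i * snd_entry z i = 0.
  rewrite (sum_rows (fun i => fst_entry z i * snd_entry z i))/= big1 ?addr0 => [|k _].
    by ring.
  by rewrite mul0r.
have snd_snd : \sum_(i < L.+2) snd_entry z i * snd_entry z i = len z ^+ 2.
  rewrite (sum_rows (fun i => snd_entry z i * snd_entry z i))/= len_sqr big_ord_recr/=.
  rewrite addrC; congr (_ + _).
  rewrite -[RHS]mul1r -(circ_sqr (height z)); ring.
apply/matrixP => i j; rewrite !mxE.
have E (f g : nat -> R) : \sum_(k < L.+2) f k * (g k / len z) =
    (\sum_(k < L.+2) f k * g k) / len z.
  by rewrite mulr_suml; apply: eq_bigr => k _; rewrite mulrA.
have E' (f g : nat -> R) : \sum_(k < L.+2) (f k / len z) * g k =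
    (\sum_(k < L.+2) f k * g k) / len z.
  by rewrite mulr_suml; apply: eq_bigr => k _; rewrite mulrAC.
under eq_bigr do rewrite !mxE.
case: i => -[|[|//]] i2; case: j => -[|[|//]] j2; rewrite -!val_eqE /= ?mulr1n ?mulr0n.
- exact: fst_fst.
- by rewrite E fst_snd mul0r.
- rewrite E' (eq_bigr (fun k : 'I_L.+2 => fst_entry z k * snd_entry z k)).
    by rewrite fst_snd mul0r.
  by move=> k _; rewrite mulrC.
rewrite (E (fun k => snd_entry z k / len z)) E' snd_snd expr2.
by rewrite mulfK // divff.
Qed.

Lemma frame_antipode z (i : 'I_L.+2) (j : 'I_2) :
  frame (mulmxr (antipode R L) z) i j = if j == ord0 then frame z i j else - frame z i j.
Proof.
rewrite mxE [frame z i j]mxE; case: ifP => _; rewrite ?len_antipode.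
  by rewrite /fst_entry height_antipode.
rewrite -mulNr; congr (_ / _); rewrite /snd_entry height_antipode.
case: i => -[|[|i]] /= il; rewrite coef_antipode ?mulrN//.
exact: ltnW.
Qed.

(** The ends of the prism lie over antipodal points of the circle, where [circ1] vanishes. The
    opposite quarter turns reverse the contribution of coefficient [L], and the twist negates the
    other coefficients, so both columns change sign. *)
Lemma frame_twist z : height z = 1 -> frame (mulmxr (twist R L) z) = - frame z.
Proof.
move=> z1; apply/matrixP => i j; rewrite [LHS]mxE [RHS]mxE [frame z i j]mxE len_twist.
have c1 : circ1 1 = 0 by rewrite /circ1 expr1n subrr mul0r.
have c1' : circ1 (-1) = 0 by rewrite /circ1 sqrrN expr1n subrr mul0r.
have c2 : circ2 (-1) = - circ2 1 by rewrite /circ2 sqrrN mulNrn mulNr.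
case: ifP => _.
  rewrite /fst_entry height_twist z1.
  by case: (val i) => [|[|k]]; rewrite ?c1 ?c1' ?c2 ?oppr0.
rewrite -mulNr; congr (_ / _); rewrite /snd_entry height_twist z1.
case: i => -[|[|i]] /= il; rewrite coef_twist//.
- by rewrite eqxx c2 opprK mulNr opprK.
- by rewrite eqxx c1 c1' !mul0r oppr0.
- by rewrite ltn_eqF.
- exact: ltnW.
Qed.

Lemma height_continuous : continuous (@height R L).
Proof. exact: coord_continuous. Qed.

Lemma coef_continuous i : continuous (fun z : V => coef z i).
Proof. exact: coord_continuous. Qed.

Lemma prism_domain_compact : compact [set z : V | prism_domain z]%classic.
Proof.
have cB : compact [set z : V | forall j, `[-1, 1]%classic (z ord0 j)]%classic.
  by apply: (@rV_compact R _ (fun=> `[-1, 1]%classic)) => _; exact: segment_compact.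
apply: (subclosed_compact _ cB) => [|z [hz cz] j /=]; last first.
  rewrite in_itv /= -ler_norml; have [->//|j0] := eqVneq j ord0.
  have jL : (j.-1 < L.+1)%N by case: j j0 => [[|j] //= jL] _.
  have -> : z ord0 j = coef z j.-1.
    by rewrite /coef prednK ?inord_val// lt0n; rewrite -val_eqE in j0.
  by rewrite -cz (bigD1 (Ordinal jL))//= lerDl sumr_ge0.
rewrite (_ : [set z : V | prism_domain z]%classic =
  ((fun z : V => `|height z|) @^-1` [set x | x <= 1] `&`
   (fun z : V => \sum_(i < L.+1) `|coef z i|) @^-1` [set x | x = 1])%classic) //.
apply: closedI; apply: (continuous_closedP _).1.
- by move=> z; apply: (@continuous_comp _ _ _ _ (fun x : R => `|x|));
    [exact: height_continuous|exact: norm_continuous].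
- exact: closed_le.
- apply: sum_continuous => i z; apply: (@continuous_comp V R R (fun z => coef z i) (fun x : R => `|x|));
    [exact: coef_continuous|exact: norm_continuous].
- exact: closed_eq.
Qed.

(** The pointwise form is needed because [frame] divides by [len], which vanishes outside the
    domain. *)
Lemma mx_continuous_at (T : topologicalType) p q (f : T -> 'M[R]_(p, q)) x :
  (forall i j, {for x, continuous (fun y => f y i j)}) -> {for x, continuous f}.
Proof.
move=> cf U [P fxP PU]; rewrite nbhs_filterE.
have : \forall y \near x, forall i j, P i j (f y i j).
  by apply: filter_forall => i; apply: filter_forall => j; exact/cf/fxP.
by apply: filterS => y Py; exact: PU.
Qed.

Lemma frame_continuous z : prism_domain z -> {for z, continuous frame}.
Proof.
move=> Dz; have l0 := domain_len Dz.
have ch : (height x @[x --> z] --> height z)%classic by exact: height_continuous.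
have cc i : (coef x i @[x --> z] --> coef z i)%classic by exact: coef_continuous.
have csq : ((height x ^+ 2 : R) @[x --> z] --> (height z ^+ 2 : R))%classic.
  exact: (cvgM ch ch).
have cden : (((1 + height x ^+ 2)^-1 : R) @[x --> z] --> ((1 + height z ^+ 2)^-1 : R))%classic.
  exact: (cvgV (circ_den (height z)) (cvgD (cvg_cst (1 : R)) csq)).
have cc1 : (circ1 (height x) @[x --> z] --> circ1 (height z))%classic.
  exact: (cvgM (cvgB (cvg_cst (1 : R)) csq) cden).
have cc2 : (circ2 (height x) @[x --> z] --> circ2 (height z))%classic.
  exact: (cvgM (cvgD ch ch) cden).
have cl : (((len x)^-1 : R) @[x --> z] --> ((len z)^-1 : R))%classic.
  have cS : continuous (fun x : V => \sum_(i < L.+1) coef x i ^+ 2).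
    apply: sum_continuous => i y.
    apply: (@continuous_comp V R R (fun z => coef z i) (fun t : R => t ^+ 2)).
      exact: coef_continuous.
    exact: exprn_continuous.
  have h := @continuous_comp V R R _ Num.sqrt z (cS z) (@sqrt_continuous R _).
  exact: (cvgV l0 h).
apply: mx_continuous_at => i j.
have -> : (fun x : V => frame x i j) =
    (fun x => if j == ord0 then fst_entry x i else snd_entry x i / len x).
  by apply/funext => x; rewrite mxE.
case: (j == ord0).
  case: (val i) => [|[|k]]; [exact: cc1|exact: cc2|exact: (@cst_continuous V R 0 z)].
case: (val i) => [|[|k]].
- exact: (cvgM (cvgM (cvgN cc2) (cc L)) cl).
- exact: (cvgM (cvgM cc1 (cc L)) cl).
- exact: (cvgM (cc k) cl).
Qed.

End Frame.

(** * The map from the prism to the Grassmannian *)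

Section PlaneMap.
Variables (R : realType) (L : nat).
Notation V := 'rV[R]_L.+2.
Notation X := (gr_tspace R L.+2 2 isT).
Implicit Types z : V.

Lemma domain_axis0 : prism_domain (axis R L 0).
Proof.
apply: (@cell_domain _ _ xpredT); apply: (@cell_vertex _ _ xpredT 0) => //.
by rewrite height_axis normr0 ler01.
Qed.

Definition base_frame : stiefel R L.+2 2 := SigSub (mem_set (frame_stiefel domain_axis0)).

(** Made total by a default frame, since [frame] need not be orthonormal outside [prism_domain]. *)
Definition plane z : X := gr_pi (insubd base_frame (frame z)).

Lemma plane_frame z : prism_domain z -> exists2 B : stiefel R L.+2 2,
  set_val B = frame z & plane z = gr_pi B.
Proof.
move=> Dz; exists (insubd base_frame (frame z)) => //.
by apply: insubdK; apply/mem_set; exact: frame_stiefel.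
Qed.

Lemma SO_opp : SO R 2 (- 1%:M).
Proof.
split.
  have -> : (- 1%:M : 'M[R]_2)^T = - 1%:M by apply/matrixP => i j; rewrite !mxE eq_sym.
  by rewrite mulmxN mulNmx opprK mulmx1.
by rewrite -scaleN1r detZ det1 mulr1 sqrrN expr1n.
Qed.

Lemma plane_antipode z : prism_domain z -> plane (mulmxr (antipode R L) z) = tinv (plane z).
Proof.
move=> Dz; have [B BE ->] := plane_frame Dz.
have [B' B'E ->] := plane_frame (domain_antipode Dz).
(* [stiefel_flip] negates the first vector and the antipode the second; they differ by [- 1%:M], a
   rotation in dimension 2. *)
rewrite [tinv _]gr_flip_pi; apply/gr_pi_eqP; exists (- 1%:M); first exact: SO_opp.
rewrite stiefel_flipE mulmxN mulmx1 BE B'E.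
apply/matrixP => i j; rewrite mul_mx_diag [LHS]mxE [RHS]mxE frame_antipode [_ ord0 j]mxE.
have -> : (j == 0 :> nat) = (j == ord0) by [].
by case: (j == ord0); rewrite ?expr1 ?mulrN1 // expr0 mulr1 opprK.
Qed.

Lemma plane_twist z : prism_domain z -> height z = 1 ->
  plane (mulmxr (twist R L) z) = plane z.
Proof.
move=> Dz z1; have [B BE ->] := plane_frame Dz.
have [B' B'E ->] := plane_frame (domain_twist Dz).
apply/gr_pi_eqP; exists (- 1%:M); first exact: SO_opp.
by rewrite BE B'E frame_twist// mulmxN mulmx1 opprK.
Qed.

Lemma plane_open (U : set X) z : open U -> prism_domain z -> U (plane z) ->
  exists2 e : R, 0 < e &
    forall v, prism_domain v -> `|z - v| < e -> U (plane v).
Proof.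
move=> oU Dz Uz; have [B BE BP] := plane_frame Dz.
have oU' : open (@gr_pi R L.+2 2 @^-1` U)%classic.
  by apply: open_comp => // x _; exact: gr_pi_continuous.
(* An open set of frames is the trace of an open set of matrices, where continuity of [frame]
   applies. *)
have [O oO OU] := oU'.
have Oz : O (frame z) by rewrite -BE -[O _]/((set_val @^-1` O)%classic B) OU /= -BP.
have /(frame_continuous Dz) := open_nbhs_nbhs (conj oO Oz).
rewrite nbhs_filterE /= => /nbhs_normP[e e0 eO]; exists e => // v Dv zv.
have [B' B'E ->] := plane_frame Dv.
suff : (set_val @^-1` O)%classic B' by rewrite OU.
by rewrite /= B'E; apply: eO.
Qed.

(** A Lebesgue number, from the near-covering form of compactness along small positive distances. *)
Lemma plane_lebesgue (A : tcover X) : exists2 d : R, 0 < d &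
  forall z, prism_domain z -> exists U : A,
    forall v, prism_domain v -> `|z - v| <= d -> fsval U (plane v).
Proof.
have /compact_near_coveringP cD := @prism_domain_compact R L.
pose good (d : R) z := exists U : A,
    forall v, prism_domain v -> `|z - v| <= d -> fsval U (plane v).
have [|d0 /= d00 dP] := cD R (0^'+)%classic good _.
  move=> z Dz; have [U UA Uz] := tcover_cover A (plane z).
  have [e e0 eU] := plane_open (tcover_open UA) Dz Uz.
  (* One half of [e] is for moving the centre from [z] to [v], the other for the distance from [v]
     to [w]. *)
  exists (ball z (e / 2), [set d : R | d < e / 2])%classic => /=.
    split; first by apply: nbhsx_ballx; rewrite divr_gt0.
    by apply: nbhs_right_lt; rewrite divr_gt0.
  move=> [v d] /= [zv de]; exists (FSetSub UA) => w Dw vw; apply: eU => //.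
  rewrite -(subrKA v); apply: (le_lt_trans (ler_normD _ _)).
  rewrite (splitr e); apply: ltr_leD; last by apply: le_trans vw _; exact: ltW.
  by move: zv; rewrite -ball_normE.
(* [dP] holds for distances strictly below [d0]. *)
exists (d0 / 2); first by rewrite divr_gt0.
have d1 : d0 / 2 < d0 by rewrite ltr_pdivrMr// ltr_pMr// ltr1n.
move=> z Dz; apply: dP Dz => //=; last by rewrite divr_gt0.
by rewrite sub0r normrN ger0_norm// ltW// divr_gt0.
Qed.

End PlaneMap.

(** * The cycle on a nerve *)

Section MainCycle.
Variables (R : realType) (L : nat).
Notation V := 'rV[R]_L.+2.
Notation X := (gr_tspace R L.+2 2 isT).
Notation bottom := (@bottom R L).
Notation top := (@top R L).
Notation orth sigma k := (orthant (@axis R L) sigma k).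

(** Points of the domain have sup norm at most 1, hence the diameter bound [1 + 1]; the prism has
    dimension [L.+1], so its simplices have at most [L.+2] vertices. *)
Lemma cell_fine sigma (x : seq V) : (size x <= L.+2)%N ->
  (forall v, v \in x -> cell sigma v) -> fine (@cell R L sigma) L.+1 (1 + 1) x.
Proof.
move=> xs xC; split=> // v w /xC vC /xC wC.
apply: (le_trans (ler_normB _ _)); apply: lerD; apply: domain_norm;
  [exact: cell_domain vC|exact: cell_domain wC].
Qed.

Lemma mem_orthant sigma k v : (k <= L.+1)%N -> v \in orth sigma k ->
  exists2 i, (i < L.+1)%N & v = if sigma i then axis R L i else - axis R L i.
Proof.
elim: k => // k IH kL; rewrite inE => /predU1P[->|]; first by exists k.
exact/IH/ltnW.
Qed.

Lemma cell_map_bottom sigma k v : (k <= L.+1)%N ->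
  v \in map bottom (orth sigma k) -> cell sigma v.
Proof.
by move=> kL /mapP[w /(mem_orthant kL)[i iL ->] ->]; exact: cell_bottom.
Qed.

Lemma cell_map_top sigma k v : (k <= L.+1)%N ->
  v \in map top (orth sigma k) -> cell sigma v.
Proof.
by move=> kL /mapP[w /(mem_orthant kL)[i iL ->] ->]; exact: cell_top.
Qed.

Lemma cell_prism sigma k x1 v x2 w : (k <= L.+1)%N -> orth sigma k = x1 ++ v :: x2 ->
  w \in map bottom x1 ++ bottom v :: top v :: map top x2 -> cell sigma w.
Proof.
move=> kL xE; rewrite mem_cat !inE => wx.
have : (w \in map bottom (orth sigma k)) || (w \in map top (orth sigma k)).
  rewrite xE !map_cat !mem_cat /= !inE.
  by move: wx => /or4P[] ->; rewrite ?orbT.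
by move=> /orP[]; [exact: cell_map_bottom|exact: cell_map_top].
Qed.

Hypothesis oddL : odd L.

Lemma nerve_cycle (A : tcover X) :
  exists2 z, z \in inv_cycles (nerve A) (@tact X A) L.+1 &
             nu (nerve A) (@tact X A) L.+1 z = 1.
Proof.
have [F FP] := equivariant_selection (plane (axis R L 0)) A.
have [d d0 dA] := plane_lebesgue A.
have [r rd] := ratio_exp_small L.+1 (1 + 1) d0.
pose E := nerve_chain F (@plane R L) r.
(* All vertices are within the Lebesgue number [d] of the first one; an empty list fits any
   member. *)
have small_cell sigma y : fine (@cell R L sigma) L.+1 (ratio R L.+1 ^+ r * (1 + 1)) y ->
    small A (@plane R L) y.
  case: y => [_|v y [_ yC yd]].
    by have [U UA _] := tcover_cover A (plane (axis R L 0)); exists (FSetSub UA).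
  have vD := cell_domain (yC v (mem_head _ _)).
  have [U UP] := dA v vD; exists U => w wy; apply: UP; first exact: cell_domain (yC w wy).
  by apply: le_trans rd; apply: yd => //; exact: mem_head.
have Ech sigma k x : size x = k.+1 -> (k <= L.+1)%N -> (forall v, v \in x -> cell sigma v) ->
    E x \in chains (nerve A) k.
  move=> xk kL xC; apply: (nerve_chain_chains FP (@cell_barycenter R L sigma)
    (small_cell sigma)) => //; apply: cell_fine => //; by rewrite xk.
have Einv sigma x : (size x <= L.+2)%N -> (forall v, v \in x -> cell sigma v) ->
    pushforward (@tact X A) (E x) = E (map (mulmxr (antipode R L)) x).
  move=> xs xC; apply: (nerve_chain_equivariant FP (@cell_barycenter R L sigma)
    (small_cell sigma) (T := mulmxr (antipode R L))); first exact: cell_fine.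
  by move=> v /cell_domain; exact: plane_antipode.
have bot_anti sigma k : (k <= L.+1)%N -> map (mulmxr (antipode R L)) (map bottom (orth sigma k)) =
    map bottom (map -%R (orth sigma k)).
  move=> kL; rewrite -!map_comp; apply/eq_in_map => v /(mem_orthant kL)[i iL ->].
  exact: antipode_bottom.
pose Ebot x := E (map bottom x); pose Etop x := E (map top x).
pose Epr := prism bottom top E.
have bE x : boundary (E x) = dl E x by exact: boundary_nerve_chain.
have H1 sigma k : (k <= L)%N -> Ebot (orth sigma k.+1) \in chains (nerve A) k.
  move=> kL; apply: (Ech sigma); first by rewrite size_map size_orthant.
    exact: leqW.
  by move=> v; exact: cell_map_bottom.
have H2 sigma k : (k <= L.+1)%N -> Epr (orth sigma k) \in chains (nerve A) k.
  move=> kL; apply: (prism_closed (S := fun c => c \in chains (nerve A) k)).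
  - exact: chains0.
  - exact: chainsD.
  move=> x1 v x2 xE; apply: (Ech sigma) => //; last by move=> w; exact: cell_prism xE.
  by rewrite size_cat /= !size_map addnS -[k](size_orthant (@axis R L) sigma) xE size_cat.
have H4 sigma k : (k <= L.+1)%N -> pushforward (@tact X A) (Ebot (orth sigma k)) =
    Ebot (map -%R (orth sigma k)).
  move=> kL; rewrite /Ebot -bot_anti//; apply: (Einv sigma).
    by rewrite size_map size_orthant leqW.
  by move=> v; exact: cell_map_bottom.
have H5 sigma k : (k <= L.+1)%N -> pushforward (@tact X A) (Epr (orth sigma k)) =
    Epr (map -%R (orth sigma k)).
  move=> kL; rewrite /Epr prism_add/= prism_map.
  rewrite (eq_prism (G' := fun y => E (map (mulmxr (antipode R L)) y))).
    rewrite prism_comp; apply: eq_in_prism => v /(mem_orthant kL)[i iL ->].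
      exact: antipode_bottom.
    exact: antipode_top.
  move=> x1 v x2 xE; apply: (Einv sigma); last by move=> w; exact: cell_prism xE.
  by rewrite size_cat /= !size_map addnS -(size_cat _ (v :: x2)) -xE size_orthant.
have H6 x : boundary (Ebot x) = dl Ebot x by rewrite /Ebot bE dl_map.
have H7 x : boundary (Epr x) = Etop x + Ebot x + dl Epr x.
  rewrite /Epr prism_add/= (eq_prism (G' := dl E)) => [|*]; last exact: bE.
  by rewrite dl_prism//; exact: addcc.
have H8 sigma k : (k <= L.+1)%N ->
    Etop (orth sigma k) = Ebot (map (mulmxr (twist R L)) (orth sigma k)).
  move=> kL; rewrite /Etop /Ebot.
  (* [plane_twist] holds at height 1 only. The top of a cell is convex, so the subdivided simplices
     stay there. *)
  pose C (z : V) := cell sigma z /\ height z = 1.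
  have Cb (x : seq V) : x <> [::] -> (forall v, v \in x -> C v) -> C (barycenter x).
    move=> x0 xC; split; first by apply: cell_barycenter => // v /xC[].
    apply/eqP; rewrite /height barycenter_entry eq_le.
    by rewrite average_le ?average_ge// => v /xC[_]; rewrite /height => ->.
  have xf : fine C L.+1 (1 + 1) (map top (orth sigma k)).
    have [] := @cell_fine sigma (map top (orth sigma k)).
    - by rewrite size_map size_orthant leqW.
    - by move=> v; exact: cell_map_top.
    move=> xs xC xd; split=> // v vx; split; first exact: xC.
    move: vx => /mapP[w /(mem_orthant kL)[i iL ->] ->].
    by rewrite heightD height_pole height_vertex add0r.
  rewrite /E (nerve_chain_invariant F r Cb (f := mulmxr (twist R L)) xf); last first.
    by move=> v [/cell_domain vD v1]; exact: plane_twist.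
  congr nerve_chain; rewrite -!map_comp; apply/eq_map => v; exact: twist_top.
exists (sphere (axis R L) L.+1 Epr).
  exact: (sphere_pr_cycle (nerve_free A) H2 erefl H5 H7 H8
    (@twist_last R L) (fun b i => @twist_vertex R L b i) (leqnn _)).
exact: (nu_sphere_pr_top (nerve_free A) H1 H2 erefl H4 H5 H6 H7 H8
  (@twist_last R L) (fun b i => @twist_vertex R L b i) (fun v => sum_nerve_chain1 F (@plane R L) r _) oddL).
Qed.

End MainCycle.

Theorem theorem1p3 (R : realType) (n : nat) (hn : (3 <= n)%N) (hodd : odd n) :
  exists N : nat,
    is_yang_index (gr_tspace R n 2 isT) N /\ (n - 1 <= N)%N.
Proof.
(* With [n = L + 2], the number [L] is odd and the cycle has dimension [L.+1], which is [n - 1]. *)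
case: n hn hodd => [|[|L]]//; rewrite subn1 /= negbK => _ oL.
have [A] := exists_tcover (gr_tspace R L.+2 2 isT).
have nt := nu_nontrivial_nerves (plane (axis R L 0)) A (@nerve_cycle R L oL).
pose P m := `[< nu_nontrivial (gr_tspace R L.+2 2 isT) m >].
have exP : exists m, P m by exists L.+1; exact/asboolP.
have ubP m : P m -> (m <= #|A|)%N by move=> /asboolP/(nu_nontrivial_bound A)/ltnW.
case: (ex_maxnP exP ubP) => N /asboolP PN maxN.
exists N; split; last by apply: maxN; exact/asboolP.
by split=> // m Pm; apply: maxN; exact/asboolP.
Qed.
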